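(* Let $f:A\to B$ be a morphism of commutative rings. Then $f$ lifts idempotents if and only if the induced ring map $K_0(f):K_0(A)\to K_0(B)$ lifts idempotents.
   Context: A morphism of rings $f:A\to B$ lifts idempotents if for every idempotent $e'\in B$ there exists an idempotent $e\in A$ with $f(e)=e'$. $K_0(A)$ is the Grothendieck ring of the semiring of isomorphism classes of finitely generated projective $A$-modules (addition $\oplus$, multiplication $\otimes_A$); its elements are written $[M,N]$ (the formal difference of the class of $M$ and the class of $N$). The ring map $K_0(f)$ is given by $[M,N]\mapsto[M\otimes_A B, N\otimes_A B]$. *)

(* Defs.v *)
From HB Require Import structures.
From mathcomp Require Import all_boot all_algebra.
From mathcomp Require Import boolp ring.

Set Implicit Arguments.
Unset Strict Implicit.
Unset Printing Implicit Defensive.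

Import GRing.Theory.
Local Open Scope ring_scope.
Local Open Scope quotient_scope.

Definition mklinear (R : pzRingType) (U V : lmodType R) (f : U -> V)
    (lf : linear f) : {linear U -> V} :=
  HB.pack f (GRing.isLinear.Build R U V *:%R f lf).

Definition surjective (S T : Type) (f : S -> T) : Prop :=
  forall y, exists x, f x = y.

Lemma inj_surj_bij (S T : Type) (f : S -> T) :
  injective f -> surjective f -> bijective f.
Proof.
move=> injf surjf.
pose g y := projT1 (cid (surjf y)).
have gK : cancel g f by move=> y; rewrite /g; case: cid.
by exists g => // x; apply: injf; rewrite gK.
Qed.

Section Modules.
Variable A : pzRingType.
Implicit Types M N P Q : lmodType A.

Definition module_iso M N : Prop := exists f : {linear M -> N}, bijective f.

Definition finitely_generated M : Prop :=
  exists n (v : 'I_n -> M), forall x, exists c : 'I_n -> A,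
    x = \sum_i c i *: v i.

Definition projective M : Prop :=
  forall P Q (g : {linear P -> Q}) (h : {linear M -> Q}),
    surjective g -> exists k : {linear M -> P}, forall x, g (k x) = h x.

Definition fgprojective M : Prop := finitely_generated M /\ projective M.

Definition dual_basis M : Prop :=
  exists (I : finType) (v : I -> M) (phi : I -> {linear M -> A^o}),
    forall x, x = \sum_i (phi i x : A) *: v i.

Lemma fg_surj M : finitely_generated M ->
  exists n (p : {linear 'rV[A]_n -> M}), surjective p.
Proof.
case=> n [v genv].
have lp : linear (fun c : 'rV[A]_n => \sum_i c 0 i *: v i).
  move=> a x y; rewrite scaler_sumr -big_split; apply: eq_bigr => i _ /=.
  by rewrite !mxE scalerDl scalerA.
exists n, (mklinear lp) => x; have [c ->] := genv x.
by exists (\row_i c i) => /=; apply: eq_bigr => i _; rewrite mxE.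
Qed.

Lemma fgprojectiveP M : fgprojective M <-> dual_basis M.
Proof.
split=> [[fgM projM]|[I [v [phi phiE]]]].
  have [n [p surjp]] := fg_surj fgM.
  have [k kK] := projM _ _ p (mklinear (f := id) (fun a x y => erefl)) surjp.
  have lphi i : linear (fun x => k x 0 i : A^o).
    by move=> a x y; rewrite linearP !mxE.
  exists 'I_n, (fun i => p (delta_mx 0 i)), (fun i => mklinear (lphi i)) => x.
  rewrite -{1}[x]kK {1}[k x]row_sum_delta linear_sum /=.
  by apply: eq_bigr => i _; rewrite linearZ.
split.
  exists #|I|, (fun i => v (enum_val i)) => x.
  exists (fun i => phi (enum_val i) x); rewrite {1}[x]phiE.
  exact: (reindex _ (onW_bij _ (enum_val_bij I))).
move=> P Q g h surjg.
have lk : linear (fun x => \sum_i (phi i x : A) *: projT1 (cid (surjg (h (v i))))).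
  move=> a x y; rewrite scaler_sumr -big_split; apply: eq_bigr => i _ /=.
  by rewrite linearP /= scalerDl scalerA.
exists (mklinear lk) => x /=.
rewrite {2}[x]phiE !linear_sum; apply: eq_bigr => i _.
by rewrite !linearZ /=; case: cid => y /= ->.
Qed.

Lemma module_iso_refl M : module_iso M M.
Proof. by exists (mklinear (f := id) (fun a x y => erefl)); exists id. Qed.

Lemma can_module_iso M N (f : {linear M -> N}) (g : N -> M) :
  cancel f g -> cancel g f -> module_iso M N.
Proof. by move=> fK gK; exists f; exists g. Qed.

Lemma module_iso_sym M N : module_iso M N -> module_iso N M.
Proof.
case=> f [g fK gK].
have lg : linear g by move=> a x y; apply: (can_inj fK); rewrite linearP !gK.
exact: (@can_module_iso _ _ (mklinear lg) f).
Qed.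

Lemma module_iso_trans M N P :
  module_iso M N -> module_iso N P -> module_iso M P.
Proof. by case=> f bijf [g bijg]; exists (g \o f); apply: bij_comp. Qed.

(* The presentations of M: all pairs (n, ker p) for p : A^n -> M onto. *)
Definition presentations M : {n & 'rV[A]_n -> Prop} -> Prop :=
  fun K => exists p : {linear 'rV[A]_(tag K) -> M},
    surjective p /\ forall c, tagged K c <-> p c = 0.

Lemma presentations_iso M N : module_iso M N ->
  forall K, presentations M K -> presentations N K.
Proof.
case=> f bijf K [p [surjp kerp]]; exists (f \o p); split=> [y|c] /=.
  case: bijf => g _ gK; have [c pc] := surjp (g y).
  by exists c; rewrite /= pc.
rewrite kerp; split=> [->|fpc]; first exact: raddf0.
by apply: (bij_inj bijf); rewrite fpc raddf0.
Qed.

Lemma linear_eq M N (f : {linear M -> N}) x y : f x = f y <-> f (x - y) = 0.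
Proof.
rewrite linearB; split=> [->|/eqP]; first by rewrite subrr.
by rewrite subr_eq0 => /eqP.
Qed.

Lemma presentationsP M N : finitely_generated M ->
  presentations M = presentations N <-> module_iso M N.
Proof.
move=> fgM; split=> [eqMN|isoMN].
  have [n [p surjp]] := fg_surj fgM.
  have: presentations M (existT _ n (fun c => p c = 0)) by exists p.
  rewrite eqMN => -[q /= [surjq kerq]].
  pose s x := projT1 (cid (surjp x)).
  have sK x : p (s x) = x by rewrite /s; case: cid.
  have eqq c d : p c = p d <-> q c = q d by rewrite !linear_eq.
  have lf : linear (q \o s).
    by move=> a x y /=; rewrite -linearP; apply/eqq; rewrite linearP !sK.
  exists (mklinear lf); apply: inj_surj_bij => [x y /eqq|y].
    by rewrite !sK.
  by have [c <-] := surjq y; exists (p c); apply/eqq; rewrite sK.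
apply/funext => K; apply/propext.
by split; apply: presentations_iso => //; apply: module_iso_sym.
Qed.

Lemma dual_basis_iso M N : module_iso M N -> dual_basis M -> dual_basis N.
Proof.
move=> /module_iso_sym [g [f gK fK]] [I [v [phi phiE]]].
have lf : linear f by move=> a x y; apply: (can_inj gK); rewrite linearP !fK.
exists I, (f \o v), (fun i => phi i \o g) => x.
rewrite -{1}[x]gK [g x]phiE -[f _]/(mklinear lf _) linear_sum.
by apply: eq_bigr => i _; rewrite linearZ_LR.
Qed.

Lemma dual_basis0 : dual_basis ('rV[A]_0).
Proof.
exists 'I_0, (fun _ => 0), (fun _ => mklinear (f := fun _ => 0 : A^o)
  (fun a x y => esym (etrans (addr0 _) (scaler0 _ _)))) => x.
by rewrite big_ord0; apply/rowP; case.
Qed.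

Lemma dual_basis1 : dual_basis A^o.
Proof.
exists unit, (fun _ => 1), (fun _ => mklinear (f := id) (fun a x y => erefl)).
move=> x; rewrite (big_pred1 tt) => [|[]//].
by rewrite /= /GRing.scale /= mulr1.
Qed.

Lemma dual_basisD M N :
  dual_basis M -> dual_basis N -> dual_basis (M * N)%type.
Proof.
case=> I [v [phi phiE]] [J [w [psi psiE]]].
exists (I + J)%type, (fun i => match i with inl i => (v i, 0) | inr j => (0, w j) end),
  (fun i : I + J => match i return {linear (M * N)%type -> A^o} with
                    | inl i => phi i \o fst | inr j => psi j \o snd end).
move=> -[x y]; rewrite big_sumType /=.
rewrite [x in LHS]phiE [y in LHS]psiE.
rewrite [LHS]surjective_pairing [RHS]surjective_pairing /= !raddf_sum /=.
congr (_, _).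
  by rewrite [X in _ = _ + X]big1 ?addr0 // => i _; rewrite /= scaler0.
by rewrite [X in _ = X + _]big1 ?add0r // => i _; rewrite /= scaler0.
Qed.

End Modules.
Section Tensor.
Variables (A : comPzRingType) (M N : lmodType A).

(* A sequence [:: (m1, n1); ...; (mk, nk)] stands for the formal sum of the   *)
(* mi (x) ni.  No formal negatives are needed: (- m, n) is opposite to (m, n) *)
(* once (0, n) is identified with the empty sum.                              *)
Inductive tensor_rel : seq (M * N) -> seq (M * N) -> Prop :=
| tensor_refl s : tensor_rel s s
| tensor_sym s t : tensor_rel s t -> tensor_rel t s
| tensor_trans s t u : tensor_rel s t -> tensor_rel t u -> tensor_rel s u
| tensor_cat s s' t t' :
    tensor_rel s s' -> tensor_rel t t' -> tensor_rel (s ++ t) (s' ++ t')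
| tensor_catC s t : tensor_rel (s ++ t) (t ++ s)
| tensor_0l n : tensor_rel [:: (0, n)] [::]
| tensor_Dl m m' n : tensor_rel [:: (m + m', n)] [:: (m, n); (m', n)]
| tensor_Dr m n n' : tensor_rel [:: (m, n + n')] [:: (m, n); (m, n')]
| tensor_Z a m n : tensor_rel [:: (a *: m, n)] [:: (m, a *: n)].

Definition tensor_relb (s t : seq (M * N)) : bool := `[< tensor_rel s t >].

Lemma tensor_relb_equiv : equiv_class_of tensor_relb.
Proof.
split=> [s|s t|t s u /asboolP st /asboolP tu].
- by apply/asboolP; apply: tensor_refl.
- by apply/asboolP/asboolP; apply: tensor_sym.
- by apply/asboolP; apply: tensor_trans tu.
Qed.

Canonical tensor_equiv : equiv_rel (seq (M * N)) :=
  EquivRelPack tensor_relb_equiv.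

Definition tensor : Type := {eq_quot tensor_equiv}.
HB.instance Definition _ := Choice.on tensor.
HB.instance Definition _ : EqQuotient (seq (M * N)) tensor_equiv tensor :=
  EqQuotient.on tensor.

Definition tensor_of (s : seq (M * N)) : tensor := \pi_tensor s.

Lemma tensor_ofP s t : tensor_of s = tensor_of t <-> tensor_rel s t.
Proof.
by split=> [/eqquotP /asboolP|st]; last by apply/eqquotP/asboolP.
Qed.

Lemma tensor_ofK (x : tensor) : tensor_of (repr x) = x.
Proof. exact: reprK. Qed.

Lemma tensor_ofW (P : tensor -> Prop) :
  (forall s, P (tensor_of s)) -> forall x, P x.
Proof. by move=> Ps x; rewrite -[x]tensor_ofK. Qed.

Lemma tensor_rel_repr s : tensor_rel (repr (tensor_of s)) s.
Proof. by apply/tensor_ofP; rewrite tensor_ofK. Qed.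

Definition tensor_map (g : M -> M) (s : seq (M * N)) : seq (M * N) :=
  [seq (g mn.1, mn.2) | mn <- s].

Lemma tensor_map_rel (g : M -> M) s t :
  linear g -> tensor_rel s t -> tensor_rel (tensor_map g s) (tensor_map g t).
Proof.
move=> lg; have [gD g0] : {morph g : x y / x + y} /\ g 0 = 0.
  by split=> [x y|]; [exact: (linearD (mklinear lg))|exact: (linear0 (mklinear lg))].
have gZ a x : g (a *: x) = a *: g x by exact: (linearZ_LR (mklinear lg)).
elim=> {s t} [s|s t _|s t u _ st _|s s' t t' _ st _ st'|s t|n|m m' n|m n n'|a m n].
- exact: tensor_refl.
- exact: tensor_sym.
- exact: tensor_trans.
- by rewrite /tensor_map !map_cat; apply: tensor_cat.
- by rewrite /tensor_map !map_cat; apply: tensor_catC.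
- by rewrite /= g0; apply: tensor_0l.
- by rewrite /= gD; apply: tensor_Dl.
- exact: tensor_Dr.
- by rewrite /= gZ; apply: tensor_Z.
Qed.

Definition tensor_add (x y : tensor) : tensor := tensor_of (repr x ++ repr y).
Definition tensor_opp (x : tensor) : tensor := tensor_of (tensor_map -%R (repr x)).
Definition tensor_scale (a : A) (x : tensor) : tensor :=
  tensor_of (tensor_map ( *:%R a) (repr x)).

Lemma tensor_addE s t : tensor_add (tensor_of s) (tensor_of t) = tensor_of (s ++ t).
Proof. by apply/tensor_ofP/tensor_cat; apply: tensor_rel_repr. Qed.

Lemma linear_opp : linear (-%R : M -> M).
Proof. by move=> a x y; rewrite opprD scalerN. Qed.

Lemma linear_scale a : linear ( *:%R a : M -> M).
Proof. by move=> b x y; rewrite scalerDr !scalerA mulrC. Qed.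

Lemma tensor_oppE s : tensor_opp (tensor_of s) = tensor_of (tensor_map -%R s).
Proof.
by apply/tensor_ofP/tensor_map_rel; [exact: linear_opp|exact: tensor_rel_repr].
Qed.

Lemma tensor_scaleE a s :
  tensor_scale a (tensor_of s) = tensor_of (tensor_map ( *:%R a) s).
Proof.
by apply/tensor_ofP/tensor_map_rel; [exact: linear_scale|exact: tensor_rel_repr].
Qed.

Lemma tensor_addA : associative tensor_add.
Proof.
elim/tensor_ofW=> s; elim/tensor_ofW=> t; elim/tensor_ofW=> u.
by rewrite !tensor_addE catA.
Qed.

Lemma tensor_addC : commutative tensor_add.
Proof.
elim/tensor_ofW=> s; elim/tensor_ofW=> t; rewrite !tensor_addE.
by apply/tensor_ofP/tensor_catC.
Qed.

Lemma tensor_add0 : left_id (tensor_of [::]) tensor_add.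
Proof. by elim/tensor_ofW=> s; rewrite tensor_addE. Qed.

Lemma tensor_addACA : interchange tensor_add tensor_add.
Proof.
move=> x y z t; rewrite -!tensor_addA; congr (tensor_add _ _).
by rewrite !tensor_addA; congr (tensor_add _ _); apply: tensor_addC.
Qed.

Lemma tensor_addN : left_inverse (tensor_of [::]) tensor_opp tensor_add.
Proof.
elim/tensor_ofW=> s; rewrite tensor_oppE tensor_addE.
elim: s => [//|[m n] s IHs].
rewrite -[LHS]/(tensor_of (([:: (- m, n)] ++ tensor_map -%R s) ++ ([:: (m, n)] ++ s))).
rewrite -!tensor_addE tensor_addACA.
rewrite [X in tensor_add _ X]tensor_addE IHs.
rewrite tensor_addC tensor_add0 tensor_addE /=.
apply/tensor_ofP; apply: tensor_trans (tensor_sym (tensor_Dl _ _ _)) _.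
by rewrite addNr; apply: tensor_0l.
Qed.

HB.instance Definition _ := GRing.isZmodule.Build tensor
  tensor_addA tensor_addC tensor_add0 tensor_addN.

Definition pure (m : M) (n : N) : tensor := tensor_of [:: (m, n)].

Lemma tensor_ofE s : tensor_of s = \sum_(mn <- s) pure mn.1 mn.2.
Proof.
elim: s => [|[m n] s IHs]; rewrite ?big_nil // big_cons -IHs.
by rewrite -cat1s -tensor_addE.
Qed.

Lemma pureDl m m' n : pure (m + m') n = pure m n + pure m' n.
Proof. by rewrite [RHS]tensor_addE; apply/tensor_ofP/tensor_Dl. Qed.

Lemma pureDr m n n' : pure m (n + n') = pure m n + pure m n'.
Proof. by rewrite [RHS]tensor_addE; apply/tensor_ofP/tensor_Dr. Qed.

Lemma pureZ a m n : pure (a *: m) n = pure m (a *: n).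
Proof. by apply/tensor_ofP/tensor_Z. Qed.

Lemma tensor_scale_pure a m n : tensor_scale a (pure m n) = pure (a *: m) n.
Proof. exact: tensor_scaleE. Qed.

Lemma tensor_scaleDr a : {morph tensor_scale a : x y / x + y}.
Proof.
elim/tensor_ofW=> s; elim/tensor_ofW=> t.
by rewrite [_ + _]tensor_addE !tensor_scaleE [RHS]tensor_addE /tensor_map map_cat.
Qed.

Lemma tensorW (P : tensor -> Prop) : P 0 ->
  (forall m n, P (pure m n)) -> (forall x y, P x -> P y -> P (x + y)) ->
  forall x, P x.
Proof.
move=> P0 P1 PD; elim/tensor_ofW=> s; rewrite tensor_ofE.
by elim/big_ind: _.
Qed.

Lemma tensor_scale0 a : tensor_scale a 0 = 0.
Proof. exact: tensor_scaleE. Qed.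

Lemma tensor_scaleA a b x :
  tensor_scale a (tensor_scale b x) = tensor_scale (a * b) x.
Proof.
elim/tensorW: x => [|m n|x y IHx IHy]; rewrite ?tensor_scale0 //.
  by rewrite !tensor_scale_pure scalerA.
by rewrite !tensor_scaleDr IHx IHy.
Qed.

Lemma tensor_scale1 : left_id 1 tensor_scale.
Proof.
elim/tensorW=> [|m n|x y IHx IHy]; rewrite ?tensor_scale0 //.
  by rewrite tensor_scale_pure scale1r.
by rewrite tensor_scaleDr IHx IHy.
Qed.

Lemma tensor_scaleDl x : {morph tensor_scale^~ x : a b / a + b}.
Proof.
move=> a b; elim/tensorW: x => [|m n|x y IHx IHy].
- by rewrite !tensor_scale0 addr0.
- by rewrite !tensor_scale_pure scalerDl pureDl.
- by rewrite !tensor_scaleDr IHx IHy addrACA.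
Qed.

HB.instance Definition _ := GRing.Zmodule_isLmodule.Build A tensor
  tensor_scaleA tensor_scale1 tensor_scaleDr tensor_scaleDl.

Lemma pureZl a m n : pure (a *: m) n = a *: pure m n.
Proof. by rewrite -tensor_scale_pure. Qed.

Lemma pureZr a m n : pure m (a *: n) = a *: pure m n.
Proof. by rewrite -pureZ pureZl. Qed.

Lemma pure0l n : pure 0 n = 0.
Proof. by rewrite -(scale0r 0) pureZl scale0r. Qed.

Lemma pure0r m : pure m 0 = 0.
Proof. by rewrite -(scale0r 0) pureZr scale0r. Qed.

Lemma pure_suml (I : Type) (r : seq I) (F : I -> M) n :
  pure (\sum_(i <- r) F i) n = \sum_(i <- r) pure (F i) n.
Proof. by elim/big_rec2: _ => [|i x y _ <-]; rewrite ?pure0l ?pureDl. Qed.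

Lemma pure_sumr (I : Type) (r : seq I) (F : I -> N) m :
  pure m (\sum_(i <- r) F i) = \sum_(i <- r) pure m (F i).
Proof. by elim/big_rec2: _ => [|i x y _ <-]; rewrite ?pure0r ?pureDr. Qed.

Section Lift.
Variables (P : zmodType) (b : M -> N -> P).
Hypotheses (bDl : forall m m' n, b (m + m') n = b m n + b m' n)
           (bDr : forall m n n', b m (n + n') = b m n + b m n')
           (bZ : forall a m n, b (a *: m) n = b m (a *: n)).

Definition tensor_lift (x : tensor) : P := \sum_(mn <- repr x) b mn.1 mn.2.

Lemma tensor_lift_rel s t : tensor_rel s t ->
  \sum_(mn <- s) b mn.1 mn.2 = \sum_(mn <- t) b mn.1 mn.2.
Proof.
elim=> {s t} [s|s t _|s t u _ st _|s s' t t' _ st _ st'|s t|n|m m' n|m n n'|a m n].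
- by [].
- by move=> ->.
- by move=> <-.
- by rewrite !big_cat /= st st'.
- by rewrite !big_cat /= addrC.
- by rewrite big_nil big_seq1 /=; apply: (addrI (b 0 n)); rewrite -bDl !addr0.
- by rewrite !big_cons !big_nil /= bDl !addr0.
- by rewrite !big_cons !big_nil /= bDr !addr0.
- by rewrite !big_seq1 /= bZ.
Qed.

Lemma tensor_lift_of s : tensor_lift (tensor_of s) = \sum_(mn <- s) b mn.1 mn.2.
Proof. exact/tensor_lift_rel/tensor_rel_repr. Qed.

Lemma tensor_lift_pure m n : tensor_lift (pure m n) = b m n.
Proof. by rewrite tensor_lift_of big_seq1. Qed.

Lemma tensor_lift0 : tensor_lift 0 = 0.
Proof. by rewrite -[0]/(tensor_of [::]) tensor_lift_of big_nil. Qed.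

Lemma tensor_liftD : {morph tensor_lift : x y / x + y}.
Proof.
elim/tensor_ofW=> s; elim/tensor_ofW=> t.
by rewrite [_ + _]tensor_addE !tensor_lift_of big_cat.
Qed.
End Lift.

End Tensor.
Section TensorTheory.
Variable A : comPzRingType.
Implicit Types M N P : lmodType A.

Lemma morph_add0 (U V : zmodType) (f : U -> V) :
  {morph f : x y / x + y} -> f 0 = 0.
Proof. by move=> fD; apply: (addrI (f 0)); rewrite -fD !addr0. Qed.

Lemma tensor_ext M N (P : zmodType) (f g : tensor M N -> P) :
  {morph f : x y / x + y} -> {morph g : x y / x + y} ->
  (forall m n, f (pure m n) = g (pure m n)) -> f =1 g.
Proof.
move=> fD gD fg; elim/tensorW=> [|//|x y fx fy].
  by rewrite (morph_add0 fD) (morph_add0 gD).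
by rewrite fD gD fx fy.
Qed.

Lemma tensor_extl M N P (f g : {linear tensor M N -> P}) :
  (forall m n, f (pure m n) = g (pure m n)) -> f =1 g.
Proof. by apply: tensor_ext => x y; rewrite linearD. Qed.

Definition bilinear_map M N P (b : M -> N -> P) : Prop :=
  (forall n, linear (b^~ n)) /\ (forall m, linear (b m)).

Section BiLift.
Variables (M N P : lmodType A) (b : M -> N -> P) (bb : bilinear_map b).

Let bDl m m' n : b (m + m') n = b m n + b m' n.
Proof. exact: (linearD (mklinear (bb.1 n))). Qed.
Let bDr m n n' : b m (n + n') = b m n + b m n'.
Proof. exact: (linearD (mklinear (bb.2 m))). Qed.
Let bZl a m n : b (a *: m) n = a *: b m n.
Proof. exact: (linearZ_LR (mklinear (bb.1 n))). Qed.
Let bZr a m n : b m (a *: n) = a *: b m n.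
Proof. exact: (linearZ_LR (mklinear (bb.2 m))). Qed.
Let bZ a m n : b (a *: m) n = b m (a *: n).
Proof. by rewrite bZl bZr. Qed.

Lemma tensor_lift_linear : linear (tensor_lift b).
Proof.
move=> a x y; rewrite tensor_liftD //; congr (_ + _).
elim/tensorW: x => [|m n|x z IHx IHz].
- by rewrite scaler0 tensor_lift0 // scaler0.
- by rewrite -pureZl !tensor_lift_pure.
- by rewrite scalerDr !tensor_liftD // IHx IHz scalerDr.
Qed.

Lemma tensor_bilift_subproof :
  {f : {linear tensor M N -> P} | forall m n, f (pure m n) = b m n}.
Proof. by exists (mklinear tensor_lift_linear) => m n; apply: tensor_lift_pure. Qed.

Definition tensor_bilift : {linear tensor M N -> P} := sval tensor_bilift_subproof.

Lemma tensor_biliftE m n : tensor_bilift (pure m n) = b m n.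
Proof. exact: (svalP tensor_bilift_subproof). Qed.
End BiLift.

Lemma pure_bilinear M N : bilinear_map (@pure A M N).
Proof.
by split=> [n|m] a x y; rewrite ?pureDl ?pureZl // pureDr pureZr.
Qed.

Lemma tensor_module_iso M N P (f : {linear tensor M N -> P}) (g : P -> tensor M N) :
  linear g -> (forall m n, g (f (pure m n)) = pure m n) -> cancel g f ->
  module_iso (tensor M N) P.
Proof.
move=> lg fK gK; apply: (can_module_iso (f := f) (g := g)) => // x.
exact: (tensor_extl (f := mklinear lg \o f) (g := mklinear (f := id) (fun a x y => erefl))).
Qed.

Lemma tensorC_bilinear M N : bilinear_map (fun (m : M) (n : N) => pure n m).
Proof. by case: (pure_bilinear N M). Qed.

Lemma tensorC M N : module_iso (tensor M N) (tensor N M).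
Proof.
have fK M' N' : cancel (tensor_bilift (tensorC_bilinear M' N'))
                       (tensor_bilift (tensorC_bilinear N' M')).
  apply: (tensor_extl (f := tensor_bilift (tensorC_bilinear N' M') \o
    tensor_bilift (tensorC_bilinear M' N')) 
    (g := mklinear (f := id) (fun a x y => erefl))) => m n /=.
  by rewrite !tensor_biliftE.
exact: can_module_iso (fK M N) (fK N M).
Qed.

Section Assoc.
Variables M N P : lmodType A.

Lemma tensorA_bil1 (p : P) :
  bilinear_map (fun (m : M) (n : N) => pure m (pure n p)).
Proof.
split=> [n|m] a x y; first by rewrite pureDl pureZl.
by rewrite pureDl pureZl pureDr pureZr.
Qed.

Lemma tensorA_bil2 :
  bilinear_map (fun (t : tensor M N) (p : P) => tensor_bilift (tensorA_bil1 p) t).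
Proof.
split=> [p|t] a x y; first exact: linearP.
apply: (tensor_ext (f := tensor_bilift (tensorA_bil1 (a *: x + y)))
  (g := fun t => a *: tensor_bilift (tensorA_bil1 x) t + tensor_bilift (tensorA_bil1 y) t)).
- exact: linearD.
- by move=> s u /=; rewrite !linearD addrACA.
- by move=> m n; rewrite !tensor_biliftE pureDr pureZr pureDr pureZr.
Qed.

Lemma tensorA_bil1' (m : M) :
  bilinear_map (fun (n : N) (p : P) => pure (pure m n) p).
Proof.
split=> [n|p] a x y; last by rewrite pureDr pureZr.
by rewrite pureDr pureZr pureDl pureZl.
Qed.

Lemma tensorA_bil2' :
  bilinear_map (fun (m : M) (t : tensor N P) => tensor_bilift (tensorA_bil1' m) t).
Proof.
split=> [t|m] a x y; last exact: linearP.
apply: (tensor_ext (f := tensor_bilift (tensorA_bil1' (a *: x + y)))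
  (g := fun t => a *: tensor_bilift (tensorA_bil1' x) t + tensor_bilift (tensorA_bil1' y) t)).
- exact: linearD.
- by move=> s u /=; rewrite !linearD addrACA.
- by move=> n p; rewrite !tensor_biliftE pureDl pureZl pureDl pureZl.
Qed.

Lemma tensorA : module_iso (tensor (tensor M N) P) (tensor M (tensor N P)).
Proof.
set f := tensor_bilift tensorA_bil2; set g := tensor_bilift tensorA_bil2'.
apply: (can_module_iso (f := f) (g := g)).
  apply: (tensor_extl (f := g \o f) (g := mklinear (f := id) (fun a x y => erefl))).
  move=> t p /=.
  apply: (tensor_ext (f := fun t => g (f (pure t p))) (g := fun t => pure t p)).
  - by move=> x y; rewrite pureDl !linearD.
  - by move=> x y; rewrite pureDl.
  - by move=> m n; rewrite /f /g !tensor_biliftE.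
apply: (tensor_extl (f := f \o g) (g := mklinear (f := id) (fun a x y => erefl))).
move=> m t /=.
apply: (tensor_ext (f := fun t => f (g (pure m t))) (g := fun t => pure m t)).
- by move=> x y; rewrite pureDr !linearD.
- by move=> x y; rewrite pureDr.
- by move=> n p; rewrite /f /g !tensor_biliftE.
Qed.
End Assoc.

Lemma tensor1_bilinear M : bilinear_map (fun (a : A^o) (m : M) => (a : A) *: m).
Proof.
split=> [m|b] a x y; first by rewrite scalerDl scalerA.
by rewrite scalerDr !scalerA mulrC.
Qed.

Lemma tensor1 M : module_iso (tensor A^o M) M.
Proof.
apply: (@tensor_module_iso _ _ _ (tensor_bilift (tensor1_bilinear M)) (pure (1 : A^o))).
- by case: (pure_bilinear A^o M).
- move=> a m; rewrite tensor_biliftE -pureZ.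
  by congr (pure _ _); apply: mulr1.
- by move=> m; rewrite tensor_biliftE scale1r.
Qed.

Lemma tensor0 M : module_iso (tensor 'rV[A]_0 M) 'rV[A]_0.
Proof.
have l0 (U V : lmodType A) : linear (fun _ : U => 0 : V).
  by move=> a x y; rewrite scaler0 addr0.
have rV0 (x y : 'rV[A]_0) : x = y by apply/rowP; case.
apply: (@tensor_module_iso _ _ _ (mklinear (l0 _ _)) (fun=> 0)) => //.
  exact: l0.
by move=> m n; rewrite (rV0 m 0) pure0l.
Qed.

Section Distr.
Variables M N P : lmodType A.

Lemma tensorDl_bilinear : bilinear_map
  (fun (mn : M * N) (p : P) => (pure mn.1 p, pure mn.2 p) : tensor M P * tensor N P).
Proof.
split=> [p|[m n]] a x y /=.
  by rewrite !pureDl !pureZl.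
by rewrite !pureDr !pureZr.
Qed.

Lemma tensorDl_inl : bilinear_map
  (fun (m : M) (p : P) => pure ((m, 0) : M * N) p).
Proof.
split=> [p|m] a x y /=; last by rewrite pureDr pureZr.
by rewrite -pureZl -pureDl; congr (pure (_, _) _); rewrite /= scaler0 addr0.
Qed.

Lemma tensorDl_inr : bilinear_map
  (fun (n : N) (p : P) => pure ((0, n) : M * N) p).
Proof.
split=> [p|m] a x y /=; last by rewrite pureDr pureZr.
by rewrite -pureZl -pureDl; congr (pure (_, _) _); rewrite /= scaler0 addr0.
Qed.

Lemma tensorDl :
  module_iso (tensor (M * N)%type P) (tensor M P * tensor N P)%type.
Proof.
set i := tensor_bilift tensorDl_inl; set j := tensor_bilift tensorDl_inr.
apply: (@tensor_module_iso _ _ _ (tensor_bilift tensorDl_bilinear)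
          (fun z => i z.1 + j z.2)).
- by move=> a [x y] [x' y'] /=; rewrite !linearP scalerDr addrACA.
- move=> [m n] p; rewrite tensor_biliftE /= !tensor_biliftE -pureDl.
  by congr (pure (_, _) _); rewrite /= ?addr0 ?add0r.
move=> [x y] /=; rewrite linearD.
have -> : tensor_bilift tensorDl_bilinear (i x) = (x, 0).
  apply: (tensor_ext (f := tensor_bilift tensorDl_bilinear \o i) (g := fun x => (x, 0))).
  - by move=> s t; rewrite linearD.
  - by move=> s t; congr (_, _); rewrite /= addr0.
  - by move=> m p; rewrite /= !tensor_biliftE /= pure0l.
have -> : tensor_bilift tensorDl_bilinear (j y) = (0, y).
  apply: (tensor_ext (f := tensor_bilift tensorDl_bilinear \o j) (g := fun x => (0, x))).
  - by move=> s t; rewrite linearD.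
  - by move=> s t; congr (_, _); rewrite /= addr0.
  - by move=> n p; rewrite /= !tensor_biliftE /= pure0l.
by congr (_, _); rewrite /= ?addr0 ?add0r.
Qed.
End Distr.

Lemma tensor_map2_bilinear M N M' N' (f : {linear M -> M'}) (g : {linear N -> N'}) :
  bilinear_map (fun m n => pure (f m) (g n)).
Proof.
by split=> [n|m] a x y; rewrite linearP ?pureDl ?pureZl // pureDr pureZr.
Qed.

Lemma tensor_iso M N M' N' : module_iso M M' -> module_iso N N' ->
  module_iso (tensor M N) (tensor M' N').
Proof.
case=> f [f' fK f'K] [g [g' gK g'K]].
have lf' : linear f' by move=> a x y; apply: (can_inj fK); rewrite linearP !f'K.
have lg' : linear g' by move=> a x y; apply: (can_inj gK); rewrite linearP !g'K.
apply: (@tensor_module_iso _ _ _ (tensor_bilift (tensor_map2_bilinear f g))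
  (tensor_bilift (tensor_map2_bilinear (mklinear lf') (mklinear lg')))).
- exact: linearP.
- by move=> m n; rewrite !tensor_biliftE /= fK gK.
apply: (tensor_extl (f := tensor_bilift (tensor_map2_bilinear f g) \o
  tensor_bilift (tensor_map2_bilinear (mklinear lf') (mklinear lg')))
  (g := mklinear (f := id) (fun a x y => erefl))) => m n /=.
by rewrite !tensor_biliftE /= f'K g'K.
Qed.

Lemma prod_iso M N M' N' : module_iso M M' -> module_iso N N' ->
  module_iso (M * N)%type (M' * N')%type.
Proof.
case=> f [f' fK f'K] [g [g' gK g'K]].
have lfg : linear (fun x : M * N => (f x.1, g x.2)).
  by move=> a [x y] [x' y'] /=; rewrite !linearP.
apply: (can_module_iso (f := mklinear lfg) (g := fun x => (f' x.1, g' x.2))).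
  by move=> [x y] /=; rewrite fK gK.
by move=> [x y] /=; rewrite f'K g'K.
Qed.

Lemma dual_basisM M N : dual_basis M -> dual_basis N -> dual_basis (tensor M N).
Proof.
case=> I [v [phi phiE]] [J [w [psi psiE]]].
have bphi i j : bilinear_map (fun m n => (phi i m : A) * (psi j n : A) : A^o).
  split=> [n|m] a x y; rewrite linearP /=.
    by rewrite mulrDl -mulrA.
  by rewrite mulrDr mulrCA.
exists (I * J)%type, (fun ij => pure (v ij.1) (w ij.2)),
  (fun ij => tensor_bilift (bphi ij.1 ij.2)).
apply: (tensor_ext (f := id)) => // [x y|m n].
  by rewrite -big_split; apply: eq_bigr => ij _; rewrite linearD /= scalerDl.
rewrite {1}[m]phiE {1}[n]psiE pure_suml.
under eq_bigr do rewrite pure_sumr.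
rewrite pair_big; apply: eq_bigr => -[i j] _ /=.
by rewrite tensor_biliftE pureZl pureZr scalerA.
Qed.

End TensorTheory.
(* B as an A-module through f. *)
Definition restrict (A B : comPzRingType) (f : {rmorphism A -> B}) : Type := B.
Arguments restrict {A B} f.

Section Restrict.
Variables (A B : comPzRingType) (f : {rmorphism A -> B}).

Local Notation restrict := (restrict f).
HB.instance Definition _ := GRing.Zmodule.on restrict.

Definition restrict_scale (a : A) (b : restrict) : restrict := f a * (b : B).

Lemma restrict_scaleA a a' b :
  restrict_scale a (restrict_scale a' b) = restrict_scale (a * a') b.
Proof. by rewrite /restrict_scale rmorphM mulrA. Qed.

Lemma restrict_scale1 : left_id 1 restrict_scale.
Proof. by move=> b; rewrite /restrict_scale rmorph1 mul1r. Qed.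

Lemma restrict_scaleDr : right_distributive restrict_scale +%R.
Proof. by move=> a b b'; apply: mulrDr. Qed.

Lemma restrict_scaleDl b : {morph restrict_scale^~ b : a a' / a + a'}.
Proof. by move=> a a'; rewrite /restrict_scale rmorphD mulrDl. Qed.

HB.instance Definition _ := GRing.Zmodule_isLmodule.Build A restrict
  restrict_scaleA restrict_scale1 restrict_scaleDr restrict_scaleDl.

Lemma restrict_scaleE (a : A) (b : restrict) : a *: b = f a * (b : B) :> B.
Proof. by []. Qed.
End Restrict.

Section Extend.
Variables (A B : comPzRingType) (f : {rmorphism A -> B}) (M : lmodType A).

(* M (x)_A B, with B acting on the second factor. *)
Definition extend : Type := tensor M (restrict f).
HB.instance Definition _ := GRing.Zmodule.on extend.

Definition epure (m : M) (b : B) : extend := pure m (b : restrict f).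

Lemma extend_scale_bilinear (b : B) : bilinear_map
  (fun (m : M) (b' : restrict f) => pure m (b * (b' : B) : restrict f)).
Proof.
split=> [b'|m] a x y; first by rewrite pureDl pureZl.
rewrite -pureZr -pureDr; congr (pure _ _).
by rewrite !restrict_scaleE mulrDr mulrCA.
Qed.

Definition extend_scale (b : B) (x : extend) : extend :=
  tensor_bilift (extend_scale_bilinear b) x.

Lemma extend_scale_pure b m b' : extend_scale b (epure m b') = epure m (b * b').
Proof. exact: tensor_biliftE. Qed.

Lemma extend_scaleDr : right_distributive extend_scale +%R.
Proof. by move=> b x y; apply: linearD. Qed.

Lemma extend_scaleA b b' x :
  extend_scale b (extend_scale b' x) = extend_scale (b * b') x.
Proof.
move: x; apply: tensor_ext => [x y|x y|m c]; rewrite ?extend_scaleDr //.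
by rewrite !extend_scale_pure mulrA.
Qed.

Lemma extend_scale1 : left_id 1 extend_scale.
Proof.
apply: tensor_ext => [x y|x y|m c]; rewrite ?extend_scaleDr //.
by rewrite extend_scale_pure mul1r.
Qed.

Lemma extend_scaleDl x : {morph extend_scale^~ x : b b' / b + b'}.
Proof.
move=> b b'; move: x; apply: tensor_ext => [x y|x y|m c].
- by rewrite extend_scaleDr.
- by rewrite !extend_scaleDr addrACA.
- by rewrite !extend_scale_pure mulrDl [LHS]pureDr.
Qed.

HB.instance Definition _ := GRing.Zmodule_isLmodule.Build B extend
  extend_scaleA extend_scale1 extend_scaleDr extend_scaleDl.

Lemma epureZ b m b' : b *: epure m b' = epure m (b * b').
Proof. exact: extend_scale_pure. Qed.

Lemma epureDl m m' b : epure (m + m') b = epure m b + epure m' b.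
Proof. exact: pureDl. Qed.

Lemma epureDr m b b' : epure m (b + b') = epure m b + epure m b'.
Proof. exact: pureDr. Qed.

Lemma epureZl a m b : epure (a *: m) b = epure m (f a * b).
Proof. exact: pureZ. Qed.

Lemma epure0 b : epure 0 b = 0.
Proof. exact: pure0l. Qed.

Lemma epure1 m b : epure m b = b *: epure m 1.
Proof. by rewrite epureZ mulr1. Qed.

Lemma extend_ext (P : lmodType B) (g h : extend -> P) :
  linear g -> linear h ->
  (forall m, g (epure m 1) = h (epure m 1)) -> g =1 h.
Proof.
move=> lg lh gh; apply: tensor_ext => [x y|x y|m b].
- exact: (linearD (mklinear lg)).
- exact: (linearD (mklinear lh)).
rewrite -[pure m b]/(epure m b) epure1.
have -> : g (b *: epure m 1) = b *: g (epure m 1) by exact: (linearZ_LR (mklinear lg)).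
by rewrite gh; apply/esym/(linearZ_LR (mklinear lh)).
Qed.

Section ExtendLift.
Variables (P : lmodType B) (g : M -> P).
Hypotheses (gD : {morph g : x y / x + y}) (gZ : forall a m, g (a *: m) = f a *: g m).

Lemma extend_lift_subproof :
  {h : {linear extend -> P} | forall m b, h (epure m b) = b *: g m}.
Proof.
pose b (m : M) (c : restrict f) := (c : B) *: g m.
have bDl m m' n : b (m + m') n = b m n + b m' n by rewrite /b gD scalerDr.
have bDr m n n' : b m (n + n') = b m n + b m n' by rewrite /b -scalerDl.
have bZ a m n : b (a *: m) n = b m (a *: n).
  by rewrite /b gZ scalerA restrict_scaleE mulrC.
have bE m c : tensor_lift b (epure m c) = c *: g m by exact: tensor_lift_pure.
have lb : linear (tensor_lift b : extend -> P).
  move=> c x y; rewrite tensor_liftD //; congr (_ + _); move: x.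
  apply: tensor_ext => [x y'|x y'|m c'].
  - by rewrite scalerDr tensor_liftD.
  - by rewrite tensor_liftD // scalerDr.
  - by rewrite epureZ !bE scalerA.
by exists (mklinear lb).
Qed.

Definition extend_lift : {linear extend -> P} := sval extend_lift_subproof.

Lemma extend_liftE m b : extend_lift (epure m b) = b *: g m.
Proof. exact: (svalP extend_lift_subproof). Qed.
End ExtendLift.

End Extend.
Arguments extend {A B} f M.
Arguments epure {A B} f {M} m b.
Arguments extend_lift {A B f M P g} gD gZ.

Section ExtendTheory.
Variables (A B : comPzRingType) (f : {rmorphism A -> B}).
Implicit Types M N : lmodType A.

Lemma id_linear (R : pzRingType) (U : lmodType R) : linear (id : U -> U).
Proof. by []. Qed.

Lemma extend_module_iso M (P : lmodType B)
    (g : {linear extend f M -> P}) (h : P -> extend f M) :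
  linear h -> (forall m, h (g (epure f m 1)) = epure f m 1) -> cancel h g ->
  module_iso (extend f M) P.
Proof.
move=> lh gK hK; apply: (can_module_iso (f := g) (g := h)) => //.
by apply: extend_ext => //; apply: (linearP (mklinear lh \o g)).
Qed.

Lemma extend_iso M N : module_iso M N -> module_iso (extend f M) (extend f N).
Proof.
case=> g [h gK hK].
have lh : linear h by move=> a x y; apply: (can_inj gK); rewrite linearP !hK.
pose e M N (k : {linear M -> N}) := epure f ^~ 1 \o k.
have eD M' N' (k : {linear M' -> N'}) : {morph e _ _ k : x y / x + y}.
  by move=> x y; rewrite /e /= linearD epureDl.
have eZ M' N' (k : {linear M' -> N'}) a x : e _ _ k (a *: x) = f a *: e _ _ k x.
  by rewrite /e /= linearZ_LR epureZl epureZ.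
pose G := extend_lift (eD _ _ g) (eZ _ _ g).
pose H := extend_lift (eD _ _ (mklinear lh)) (eZ _ _ (mklinear lh)).
apply: (extend_module_iso (g := G) (h := H)); first exact: linearP.
  by move=> m; rewrite !extend_liftE !scale1r /= !extend_liftE scale1r /e /= gK.
apply: extend_ext => //; first exact: (linearP (G \o H)).
by move=> m; rewrite /= !extend_liftE !scale1r /= !extend_liftE scale1r /e /= hK.
Qed.

Lemma extend_dual_basis M : dual_basis M -> dual_basis (extend f M).
Proof.
case=> I [v [phi phiE]].
have eD i : {morph (fun m => f (phi i m) : B^o) : x y / x + y}.
  by move=> x y; rewrite linearD rmorphD.
have eZ i a m : f (phi i (a *: m)) = f a *: (f (phi i m) : B^o).
  by rewrite linearZ_LR /= rmorphM.
exists I, (fun i => epure f (v i) 1), (fun i => extend_lift (eD i) (eZ i)).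
apply: extend_ext => // [b x y|m].
  rewrite scaler_sumr -big_split; apply: eq_bigr => i _.
  by rewrite linearP /= scalerDl scalerA.
transitivity (\sum_i epure f (phi i m *: v i) 1).
  by rewrite [m in LHS]phiE; elim/big_rec2: _ => [|i x y _ <-];
    rewrite ?epure0 ?epureDl.
apply: eq_bigr => i _; rewrite extend_liftE scale1r epureZl.
by rewrite epureZ.
Qed.

Lemma extend0 : module_iso (extend f 'rV[A]_0) 'rV[B]_0.
Proof.
have l0 (U V : lmodType B) : linear (fun _ : U => 0 : V).
  by move=> a x y; rewrite scaler0 addr0.
have rV0 (R : comPzRingType) (x y : 'rV[R]_0) : x = y by apply/rowP; case.
apply: (@extend_module_iso _ _ (mklinear (l0 _ _)) (fun=> 0)) => //.
- exact: l0.
- by move=> m; rewrite (rV0 _ m 0) epure0.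
- by move=> y; apply: rV0.
Qed.

Lemma extend1 : module_iso (extend f A^o) B^o.
Proof.
have fD : {morph (f : A^o -> B^o) : x y / x + y} by move=> x y; apply: rmorphD.
have fZ a (m : A^o) : f (a *: m) = f a *: (f m : B^o) by apply: rmorphM.
apply: (@extend_module_iso _ _ (extend_lift fD fZ) (fun b : B => epure f (1 : A^o) b)).
- by move=> b x y; rewrite epureDr epureZ.
- move=> m; rewrite extend_liftE scale1r -[m in RHS]mulr1.
  by rewrite -[m * 1]/(m *: (1 : A^o)) epureZl mulr1.
by move=> b; rewrite extend_liftE rmorph1 -[LHS]/(b * 1) mulr1.
Qed.

Lemma extendD M N : module_iso (extend f (M * N)%type) (extend f M * extend f N)%type.
Proof.
pose g (x : M * N) : extend f M * extend f N := (epure f x.1 1, epure f x.2 1).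
have gD : {morph g : x y / x + y} by move=> x y; rewrite /g !epureDl.
have gZ a x : g (a *: x) = f a *: g x.
  by rewrite /g !epureZl /=; congr (_, _); rewrite epureZ.
pose i (m : M) : extend f (M * N)%type := epure f (m, 0) 1.
pose j (n : N) : extend f (M * N)%type := epure f (0, n) 1.
have iD : {morph i : x y / x + y}.
  by move=> x y; rewrite /i -epureDl; congr (epure f (_, _) _); rewrite /= addr0.
have jD : {morph j : x y / x + y}.
  by move=> x y; rewrite /j -epureDl; congr (epure f (_, _) _); rewrite /= addr0.
have iZ a x : i (a *: x) = f a *: i x.
  by rewrite /i epureZ -epureZl; congr (epure f (_, _) _); rewrite /= scaler0.
have jZ a x : j (a *: x) = f a *: j x.
  by rewrite /j epureZ -epureZl; congr (epure f (_, _) _); rewrite /= scaler0.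
pose G := extend_lift gD gZ; pose I := extend_lift iD iZ; pose J := extend_lift jD jZ.
apply: (@extend_module_iso _ _ G (fun z => I z.1 + J z.2)).
- by move=> b [x y] [x' y']; rewrite /= !linearP scalerDr addrACA.
- move=> [m n]; rewrite !extend_liftE !scale1r /= !extend_liftE !scale1r /i /j -epureDl.
  by congr (epure f (_, _) _); rewrite /= ?addr0 ?add0r.
move=> [x y] /=; rewrite linearD.
have -> : G (I x) = (x, 0).
  move: x; apply: extend_ext => [|b x x'|m].
  - exact: (linearP (G \o I)).
  - by congr (_, _); rewrite /= scaler0 addr0.
  - by rewrite !extend_liftE !scale1r !extend_liftE scale1r /g /= epure0.
have -> : G (J y) = (0, y).
  move: y; apply: extend_ext => [|b y y'|m].
  - exact: (linearP (G \o J)).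
  - by congr (_, _); rewrite /= scaler0 addr0.
  - by rewrite !extend_liftE !scale1r !extend_liftE scale1r /g /= epure0.
by congr (_, _); rewrite /= ?addr0 ?add0r.
Qed.

Lemma extendM M N :
  module_iso (extend f (tensor M N)) (tensor (extend f M) (extend f N)).
Proof.
pose E := tensor (extend f M) (extend f N).
(* m (x) n |-> (m (x) 1) (x) (n (x) 1) *)
pose u (m : M) (n : N) : E := pure (epure f m 1) (epure f n 1).
have uDl m m' n : u (m + m') n = u m n + u m' n by rewrite /u epureDl pureDl.
have uDr m n n' : u m (n + n') = u m n + u m n' by rewrite /u epureDl pureDr.
have uZl a m n : u (a *: m) n = f a *: u m n.
  by rewrite /u epureZl -epureZ pureZl.
have uZr a m n : u m (a *: n) = f a *: u m n.
  by rewrite /u epureZl -epureZ pureZr.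
have uZ a m n : u (a *: m) n = u m (a *: n) by rewrite uZl uZr.
have uE m n : tensor_lift u (pure m n) = u m n by exact: tensor_lift_pure.
have gD : {morph tensor_lift u : x y / x + y} by exact: tensor_liftD.
have gZ a x : tensor_lift u (a *: x) = f a *: tensor_lift u x.
  move: x; apply: tensor_ext => [x y|x y|m n].
  - by rewrite scalerDr gD.
  - by rewrite gD scalerDr.
  - by rewrite -pureZl !uE uZl.
pose G : {linear extend f (tensor M N) -> E} := extend_lift gD gZ.
pose k (m : M) (n : N) : extend f (tensor M N) := epure f (pure m n) 1.
have kD m : {morph k m : n n' / n + n'}.
  by move=> n n'; rewrite /k pureDr epureDl.
have kZ m a n : k m (a *: n) = f a *: k m n.
  by rewrite /k pureZr epureZl epureZ.
pose K m : {linear extend f N -> extend f (tensor M N)} :=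
  extend_lift (kD m) (kZ m).
have KE m n b : K m (epure f n b) = b *: k m n by exact: extend_liftE.
have KD m m' y : K (m + m') y = K m y + K m' y.
  move: y; apply: extend_ext => [||n].
  - exact: linearP.
  - by move=> b y y'; rewrite !linearP scalerDr addrACA.
  - by rewrite !KE !scale1r /k pureDl epureDl.
have KZ a m y : K (a *: m) y = f a *: K m y.
  move: y; apply: extend_ext => [||n].
  - exact: linearP.
  - by move=> b y y'; rewrite linearP scalerDr !scalerA mulrC.
  - by rewrite !KE !scale1r /k pureZl epureZl epureZ.
pose L y : {linear extend f M -> extend f (tensor M N)} :=
  extend_lift (fun m m' => KD m m' y) (fun a m => KZ a m y).
have LE y m b : L y (epure f m b) = b *: K m y by exact: extend_liftE.
have bL : bilinear_map (fun x y => L y x).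
  split=> [y|x] b z z'; first exact: linearP.
  move: x; apply: extend_ext => [||m].
  - exact: linearP.
  - by move=> c x x'; rewrite (linearP (L z)) (linearP (L z')) !scalerDr !scalerA mulrC addrACA.
  - by rewrite !LE !scale1r linearP.
apply: (@extend_module_iso _ _ G (tensor_bilift bL)).
- exact: linearP.
- have GE t : G (epure f t 1) = tensor_lift u t by rewrite extend_liftE scale1r.
  apply: tensor_ext => [x y|x y|m n]; first by rewrite epureDl !linearD.
    by rewrite epureDl.
  by rewrite GE uE tensor_biliftE LE KE !scale1r.
apply: tensor_ext => [x y|//|x y]; first by rewrite !linearD.
rewrite tensor_biliftE; move: x; apply: extend_ext => [||m].
- exact: (linearP (G \o L y)).
- by move=> b x x'; rewrite pureDl pureZl.
rewrite LE scale1r; move: y; apply: extend_ext => [||n].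
- exact: (linearP (G \o K m)).
- by move=> b y y'; rewrite pureDr pureZr.
by rewrite KE scale1r extend_liftE scale1r uE.
Qed.

End ExtendTheory.
Section IsoClass.
Variable A : comPzRingType.
Implicit Types M N P : lmodType A.

(* The isomorphism class of a finitely generated module M is encoded by       *)
(* presentations M, which by presentationsP determines M up to isomorphism.   *)
(* The classes then form a type in the universe of A, whereas one built on    *)
(* lmodType A would be too large for K0 A to be a comPzRingType.              *)
Record isoclass : Type := IsoClass {
  isoclass_val : {n & 'rV[A]_n -> Prop} -> Prop;
  isoclassP : exists M, fgprojective M /\ presentations M = isoclass_val
}.
HB.instance Definition _ := gen_eqMixin isoclass.
HB.instance Definition _ := gen_choiceMixin isoclass.

Definition iso_class M (fgM : fgprojective M) : isoclass :=
  IsoClass (ex_intro _ M (conj fgM erefl)).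

Lemma iso_classP M N (fgM : fgprojective M) (fgN : fgprojective N) :
  iso_class fgM = iso_class fgN <-> module_iso M N.
Proof.
rewrite -(presentationsP N fgM.1); split=> [[]//|eqMN].
rewrite /iso_class; move: (ex_intro _ M _) (ex_intro _ N _); rewrite eqMN.
by move=> p q; rewrite (Prop_irrelevance p q).
Qed.

Lemma iso_classW (x : isoclass) : exists M (fgM : fgprojective M), x = iso_class fgM.
Proof.
case: x => X [M [fgM eqX]]; exists M, fgM; rewrite /iso_class.
move: (ex_intro _ M _) (ex_intro _ M _); rewrite eqX => p q.
by rewrite (Prop_irrelevance p q).
Qed.

Definition isoclass_repr (x : isoclass) : lmodType A := projT1 (cid (isoclassP x)).

Lemma isoclass_reprP x : fgprojective (isoclass_repr x).
Proof. by rewrite /isoclass_repr; case: cid => M []. Qed.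

Lemma isoclass_reprK x : iso_class (isoclass_reprP x) = x.
Proof.
have [M [fgM ->]] := iso_classW x; apply/iso_classP.
apply/(presentationsP _ (isoclass_reprP _).1).
by rewrite /isoclass_repr; case: cid => N [].
Qed.

Lemma isoclass_repr_iso M (fgM : fgprojective M) :
  module_iso (isoclass_repr (iso_class fgM)) M.
Proof. by apply/(iso_classP (isoclass_reprP _) fgM); rewrite isoclass_reprK. Qed.

Lemma fgprojective0 : fgprojective 'rV[A]_0.
Proof. exact/fgprojectiveP/dual_basis0. Qed.

Lemma fgprojective1 : fgprojective A^o.
Proof. exact/fgprojectiveP/dual_basis1. Qed.

Lemma fgprojectiveD M N :
  fgprojective M -> fgprojective N -> fgprojective (M * N)%type.
Proof. by move=> /fgprojectiveP ? /fgprojectiveP ?; apply/fgprojectiveP/dual_basisD. Qed.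

Lemma fgprojectiveM M N :
  fgprojective M -> fgprojective N -> fgprojective (tensor M N).
Proof. by move=> /fgprojectiveP ? /fgprojectiveP ?; apply/fgprojectiveP/dual_basisM. Qed.

Definition isoclass0 : isoclass := iso_class fgprojective0.
Definition isoclass1 : isoclass := iso_class fgprojective1.
Definition isoclass_add (x y : isoclass) : isoclass :=
  iso_class (fgprojectiveD (isoclass_reprP x) (isoclass_reprP y)).
Definition isoclass_mul (x y : isoclass) : isoclass :=
  iso_class (fgprojectiveM (isoclass_reprP x) (isoclass_reprP y)).

Lemma isoclass_addE M N (fgM : fgprojective M) (fgN : fgprojective N) :
  isoclass_add (iso_class fgM) (iso_class fgN) = iso_class (fgprojectiveD fgM fgN).
Proof. by apply/iso_classP/prod_iso; apply: isoclass_repr_iso. Qed.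

Lemma isoclass_mulE M N (fgM : fgprojective M) (fgN : fgprojective N) :
  isoclass_mul (iso_class fgM) (iso_class fgN) = iso_class (fgprojectiveM fgM fgN).
Proof. by apply/iso_classP/tensor_iso; apply: isoclass_repr_iso. Qed.

Lemma isoclass_addA : associative isoclass_add.
Proof.
move=> x y z; have [M [fgM ->]] := iso_classW x.
have [N [fgN ->]] := iso_classW y; have [P [fgP ->]] := iso_classW z.
rewrite !isoclass_addE; apply/iso_classP.
have lf : linear (fun u : M * (N * P) => ((u.1, u.2.1), u.2.2)) by [].
by apply: (can_module_iso (f := mklinear lf) (g := fun u => (u.1.1, (u.1.2, u.2))));
  [move=> [x1 []]|move=> [[]]].
Qed.

Lemma isoclass_addC : commutative isoclass_add.
Proof.
move=> x y; have [M [fgM ->]] := iso_classW x; have [N [fgN ->]] := iso_classW y.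
rewrite !isoclass_addE; apply/iso_classP.
have lf : linear (fun u : M * N => (u.2, u.1)) by [].
by apply: (can_module_iso (f := mklinear lf) (g := fun u => (u.2, u.1))); case.
Qed.

Lemma isoclass_add0 : left_id isoclass0 isoclass_add.
Proof.
move=> x; have [M [fgM ->]] := iso_classW x.
rewrite isoclass_addE; apply/iso_classP.
have lf : linear (fun u : 'rV[A]_0 * M => u.2) by [].
apply: (can_module_iso (f := mklinear lf) (g := fun u => (0, u))) => //= -[u v] /=.
by congr (_, _); apply/rowP; case.
Qed.

HB.instance Definition _ := GRing.isNmodule.Build isoclass
  isoclass_addA isoclass_addC isoclass_add0.

Lemma isoclass_mulA : associative isoclass_mul.
Proof.
move=> x y z; have [M [fgM ->]] := iso_classW x.
have [N [fgN ->]] := iso_classW y; have [P [fgP ->]] := iso_classW z.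
by rewrite !isoclass_mulE; apply/iso_classP/module_iso_sym/tensorA.
Qed.

Lemma isoclass_mulC : commutative isoclass_mul.
Proof.
move=> x y; have [M [fgM ->]] := iso_classW x; have [N [fgN ->]] := iso_classW y.
by rewrite !isoclass_mulE; apply/iso_classP/tensorC.
Qed.

Lemma isoclass_mul1 : left_id isoclass1 isoclass_mul.
Proof.
move=> x; have [M [fgM ->]] := iso_classW x.
by rewrite isoclass_mulE; apply/iso_classP/tensor1.
Qed.

Lemma isoclass_mul0 : left_zero isoclass0 isoclass_mul.
Proof.
move=> x; have [M [fgM ->]] := iso_classW x.
by rewrite isoclass_mulE; apply/iso_classP/tensor0.
Qed.

Lemma isoclass_mulDl : left_distributive isoclass_mul isoclass_add.
Proof.
move=> x y z; have [M [fgM ->]] := iso_classW x.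
have [N [fgN ->]] := iso_classW y; have [P [fgP ->]] := iso_classW z.
by rewrite !(isoclass_addE, isoclass_mulE); apply/iso_classP/tensorDl.
Qed.

HB.instance Definition _ := GRing.Nmodule_isComPzSemiRing.Build isoclass
  isoclass_mulA isoclass_mulC isoclass_mul1 isoclass_mulDl isoclass_mul0.

Lemma iso_class0 : 0 = iso_class fgprojective0.
Proof. by []. Qed.

Lemma iso_class1 : 1 = iso_class fgprojective1.
Proof. by []. Qed.

Lemma iso_classD M N (fgM : fgprojective M) (fgN : fgprojective N) :
  iso_class fgM + iso_class fgN = iso_class (fgprojectiveD fgM fgN).
Proof. exact: isoclass_addE. Qed.

Lemma iso_classM M N (fgM : fgprojective M) (fgN : fgprojective N) :
  iso_class fgM * iso_class fgN = iso_class (fgprojectiveM fgM fgN).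
Proof. exact: isoclass_mulE. Qed.

End IsoClass.

Section IsoClassMap.
Variables (A B : comPzRingType) (f : {rmorphism A -> B}).
Implicit Types M N : lmodType A.

Lemma fgprojective_extend M : fgprojective M -> fgprojective (extend f M).
Proof. by move=> /fgprojectiveP ?; apply/fgprojectiveP/extend_dual_basis. Qed.

Definition isoclass_map (x : isoclass A) : isoclass B :=
  iso_class (fgprojective_extend (isoclass_reprP x)).

Lemma isoclass_mapE M (fgM : fgprojective M) :
  isoclass_map (iso_class fgM) = iso_class (fgprojective_extend fgM).
Proof. by apply/iso_classP/extend_iso; apply: isoclass_repr_iso. Qed.

Lemma isoclass_map_nmod : nmod_morphism isoclass_map.
Proof.
split=> [|x y]; first by rewrite !iso_class0 isoclass_mapE; apply/iso_classP/extend0.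
have [M [fgM ->]] := iso_classW x; have [N [fgN ->]] := iso_classW y.
by rewrite iso_classD !isoclass_mapE iso_classD; apply/iso_classP/extendD.
Qed.

Lemma isoclass_map_monoid : monoid_morphism isoclass_map.
Proof.
split=> [|x y]; first by rewrite !iso_class1 isoclass_mapE; apply/iso_classP/extend1.
have [M [fgM ->]] := iso_classW x; have [N [fgN ->]] := iso_classW y.
by rewrite iso_classM !isoclass_mapE iso_classM; apply/iso_classP/extendM.
Qed.

HB.instance Definition _ := GRing.isNmodMorphism.Build (isoclass A) (isoclass B)
  isoclass_map isoclass_map_nmod.
HB.instance Definition _ := GRing.isMonoidMorphism.Build (isoclass A) (isoclass B)
  isoclass_map isoclass_map_monoid.
End IsoClassMap.

Section Grothendieck.
Variable S : comPzSemiRingType.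

Definition groth_rel (x y : S * S) : bool :=
  `[< exists k, x.1 + y.2 + k = y.1 + x.2 + k >].

Lemma groth_rel_equiv : equiv_class_of groth_rel.
Proof.
split=> [x|x y|[c d] [a b] [e f]].
- by apply/asboolP; exists 0.
- by apply/asboolP/asboolP => -[k eqk]; exists k.
move=> /asboolP[k /= abcd] /asboolP[l /= cdef]; apply/asboolP; exists (d + k + l) => /=.
have -> : a + f + (d + k + l) = a + d + k + (f + l) by ring.
have -> : e + b + (d + k + l) = c + f + l + (b + k) by rewrite cdef; ring.
by rewrite abcd; ring.
Qed.

Canonical groth_equiv : equiv_rel (S * S) := EquivRelPack groth_rel_equiv.

Definition groth : Type := {eq_quot groth_equiv}.
HB.instance Definition _ := Choice.on groth.
HB.instance Definition _ : EqQuotient (S * S)%type groth_equiv groth :=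
  EqQuotient.on groth.

(* The formal difference [x, y]. *)
Definition groth_diff (x y : S) : groth := \pi_groth (x, y).

Lemma groth_diffP x y z t :
  groth_diff x y = groth_diff z t <-> exists k, x + t + k = z + y + k.
Proof. by split=> [/eqquotP /asboolP|?]; last by apply/eqquotP/asboolP. Qed.

Lemma groth_diffW (u : groth) : exists x y, u = groth_diff x y.
Proof.
by exists (repr u).1, (repr u).2; rewrite /groth_diff -surjective_pairing reprK.
Qed.

Lemma groth_reprP x y : exists k,
  (repr (groth_diff x y)).1 + y + k = x + (repr (groth_diff x y)).2 + k.
Proof.
by apply/groth_diffP; rewrite /groth_diff -surjective_pairing reprK.
Qed.

Definition groth_add (u v : groth) : groth :=
  groth_diff ((repr u).1 + (repr v).1) ((repr u).2 + (repr v).2).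
Definition groth_opp (u : groth) : groth := groth_diff (repr u).2 (repr u).1.
Definition groth_mul (u v : groth) : groth :=
  groth_diff ((repr u).1 * (repr v).1 + (repr u).2 * (repr v).2)
             ((repr u).1 * (repr v).2 + (repr u).2 * (repr v).1).

Lemma groth_addE x y z t :
  groth_add (groth_diff x y) (groth_diff z t) = groth_diff (x + z) (y + t).
Proof.
have [k ek] := groth_reprP x y; have [l el] := groth_reprP z t.
apply/groth_diffP; exists (k + l); rewrite /groth_add.
transitivity ((repr (groth_diff x y)).1 + y + k +
              ((repr (groth_diff z t)).1 + t + l)); first by rewrite /=; ring.
by rewrite ek el; ring.
Qed.

Lemma groth_oppE x y : groth_opp (groth_diff x y) = groth_diff y x.
Proof.
have [k ek] := groth_reprP x y; apply/groth_diffP; exists k.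
by rewrite [_ + x]addrC -ek [y + _]addrC.
Qed.

Lemma groth_mul_compat x y x' y' z t : (exists k, x + y' + k = x' + y + k) ->
  groth_diff (x * z + y * t) (x * t + y * z) =
  groth_diff (x' * z + y' * t) (x' * t + y' * z).
Proof.
case=> k ek; apply/groth_diffP; exists (k * z + k * t).
transitivity ((x + y' + k) * z + (x' + y + k) * t); first ring.
by rewrite ek -{1}ek -ek {1}ek; ring.
Qed.

Lemma groth_mulE x y z t :
  groth_mul (groth_diff x y) (groth_diff z t) =
  groth_diff (x * z + y * t) (x * t + y * z).
Proof.
rewrite /groth_mul (groth_mul_compat _ _ (groth_reprP x y)).
set z' := (repr _).1; set t' := (repr _).2.
transitivity (groth_diff (z' * x + t' * y) (z' * y + t' * x)).
  by congr groth_diff; ring.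
rewrite (groth_mul_compat _ _ (groth_reprP z t)).
by congr groth_diff; ring.
Qed.

Lemma groth_addA : associative groth_add.
Proof.
move=> u v w; have [a [b ->]] := groth_diffW u; have [c [d ->]] := groth_diffW v.
by have [e [g ->]] := groth_diffW w; rewrite !groth_addE !addrA.
Qed.

Lemma groth_addC : commutative groth_add.
Proof.
move=> u v; have [a [b ->]] := groth_diffW u; have [c [d ->]] := groth_diffW v.
by rewrite !groth_addE addrC [b + d]addrC.
Qed.

Lemma groth_add0 : left_id (groth_diff 0 0) groth_add.
Proof. by move=> u; have [a [b ->]] := groth_diffW u; rewrite groth_addE !add0r. Qed.

Lemma groth_addN : left_inverse (groth_diff 0 0) groth_opp groth_add.
Proof.
move=> u; have [a [b ->]] := groth_diffW u; rewrite groth_oppE groth_addE.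
by apply/groth_diffP; exists 0; ring.
Qed.

HB.instance Definition _ := GRing.isZmodule.Build groth
  groth_addA groth_addC groth_add0 groth_addN.

Lemma groth_mulA : associative groth_mul.
Proof.
move=> u v w; have [a [b ->]] := groth_diffW u; have [c [d ->]] := groth_diffW v.
have [e [g ->]] := groth_diffW w; rewrite !groth_mulE.
by congr groth_diff; ring.
Qed.

Lemma groth_mulC : commutative groth_mul.
Proof.
move=> u v; have [a [b ->]] := groth_diffW u; have [c [d ->]] := groth_diffW v.
by rewrite !groth_mulE; congr groth_diff; ring.
Qed.

Lemma groth_mul1 : left_id (groth_diff 1 0) groth_mul.
Proof.
move=> u; have [a [b ->]] := groth_diffW u.
by rewrite groth_mulE; congr groth_diff; ring.
Qed.

Lemma groth_mulDl : left_distributive groth_mul groth_add.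
Proof.
move=> u v w; have [a [b ->]] := groth_diffW u; have [c [d ->]] := groth_diffW v.
have [e [g ->]] := groth_diffW w; rewrite !(groth_addE, groth_mulE).
by congr groth_diff; ring.
Qed.

HB.instance Definition _ := GRing.Zmodule_isComPzRing.Build groth
  groth_mulA groth_mulC groth_mul1 groth_mulDl.

Lemma groth_diff0 : 0 = groth_diff 0 0.
Proof. by []. Qed.

Lemma groth_diff1 : 1 = groth_diff 1 0.
Proof. by []. Qed.

Lemma groth_diffD x y z t :
  groth_diff x y + groth_diff z t = groth_diff (x + z) (y + t).
Proof. exact: groth_addE. Qed.

Lemma groth_diffN x y : - groth_diff x y = groth_diff y x.
Proof. exact: groth_oppE. Qed.

Lemma groth_diffM x y z t : groth_diff x y * groth_diff z t =
  groth_diff (x * z + y * t) (x * t + y * z).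
Proof. exact: groth_mulE. Qed.

End Grothendieck.

Section GrothendieckMap.
Variables (S T : comPzSemiRingType) (f : {rmorphism S -> T}).

Definition groth_map (u : groth S) : groth T := groth_diff (f (repr u).1) (f (repr u).2).

Lemma groth_mapE x y : groth_map (groth_diff x y) = groth_diff (f x) (f y).
Proof.
have [k ek] := groth_reprP x y; apply/groth_diffP; exists (f k).
by rewrite -!rmorphD ek.
Qed.

Lemma groth_map_zmod : zmod_morphism groth_map.
Proof.
move=> u v; have [a [b ->]] := groth_diffW u; have [c [d ->]] := groth_diffW v.
by rewrite groth_diffN groth_diffD !groth_mapE groth_diffN groth_diffD !rmorphD.
Qed.

Lemma groth_map_monoid : monoid_morphism groth_map.
Proof.
split=> [|u v]; first by rewrite groth_diff1 groth_mapE rmorph0 rmorph1.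
have [a [b ->]] := groth_diffW u; have [c [d ->]] := groth_diffW v.
by rewrite groth_diffM !groth_mapE groth_diffM !rmorphD !rmorphM.
Qed.

HB.instance Definition _ := GRing.isZmodMorphism.Build (groth S) (groth T)
  groth_map groth_map_zmod.
HB.instance Definition _ := GRing.isMonoidMorphism.Build (groth S) (groth T)
  groth_map groth_map_monoid.
End GrothendieckMap.

Definition K0 (A : comPzRingType) : comPzRingType := groth (isoclass A).

Definition K0_map (A B : comPzRingType) (f : {rmorphism A -> B}) :
  {rmorphism K0 A -> K0 B} := groth_map (isoclass_map f).

(* The element [M, N] of K0 A. *)
Definition K0_diff (A : comPzRingType) (M N : lmodType A)
    (fgM : fgprojective M) (fgN : fgprojective N) : K0 A :=
  groth_diff (iso_class fgM) (iso_class fgN).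

Lemma K0_diffW (A : comPzRingType) (u : K0 A) :
  exists M N (fgM : fgprojective M) (fgN : fgprojective N), u = K0_diff fgM fgN.
Proof.
have [x [y ->]] := groth_diffW u; have [M [fgM ->]] := iso_classW x.
by have [N [fgN ->]] := iso_classW y; exists M, N, fgM, fgN.
Qed.

Lemma K0_diffP (A : comPzRingType) (M N M' N' : lmodType A)
    (fgM : fgprojective M) (fgN : fgprojective N)
    (fgM' : fgprojective M') (fgN' : fgprojective N') :
  K0_diff fgM fgN = K0_diff fgM' fgN' <->
  exists P : lmodType A, fgprojective P /\
    module_iso ((M * N') * P)%type ((M' * N) * P)%type.
Proof.
rewrite /K0_diff groth_diffP; split=> [[k]|[P [fgP isoP]]].
  have [P [fgP ->]] := iso_classW k.
  rewrite (iso_classD fgM) (iso_classD fgM') !iso_classD => /iso_classP isoP.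
  by exists P; split.
by exists (iso_class fgP); rewrite (iso_classD fgM) (iso_classD fgM') !iso_classD;
  apply/iso_classP.
Qed.

Lemma K0_mapE (A B : comPzRingType) (f : {rmorphism A -> B}) (M N : lmodType A)
    (fgM : fgprojective M) (fgN : fgprojective N) :
  K0_map f (K0_diff fgM fgN) =
  K0_diff (fgprojective_extend f fgM) (fgprojective_extend f fgN).
Proof. by rewrite /K0_diff [LHS]groth_mapE /= !isoclass_mapE. Qed.

Definition lifts_idempotents (R S : pzRingType) (f : {rmorphism R -> S}) : Prop :=
  forall e' : S, e' * e' = e' -> exists e : R, e * e = e /\ f e = e'.

(* Main.v *)
Require Import Defs.
From mathcomp Require Import all_boot all_algebra.
From HB Require Import structures.
From mathcomp Require Import perm ring.

(* Idempotents of A correspond bijectively and naturally to idempotents of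
   K_0(A), through e |-> [eA]; the theorem follows at once. Call v = [M, N]
   s-factorizable if there are a : M -> N and b : N -> M with b a = s and a b
   = s. The s-factorizable classes form an ideal F_s of K_0(A), F_1 = 0, and
   the tensor product of matrix factorizations gives F_s F_t <= F_(s+t). Hence
   for an idempotent u the scalars s with u in F_s form an ideal I_u. The
   class v = [eA] is the only one with v in F_(1-e) and 1 - v in F_e. If a
   nonzero integer lies in F_s, then s is nilpotent, by comparing ranks of
   free modules. So elements of I_u I_(1-u) are nilpotent, and if [P] - r and
   [Q] - r' lie in F_s, where u = [P] - [Q], then s lies in the radical of I_u
   + I_(1-u): with j = r - r', j^2 - j = (u - j)(1 - u - j) is in F_s, so j is
   0 or 1 or s is nilpotent. As a finitely generated projective module is
   locally free, such s generate the unit ideal, and I_u + I_(1-u) = A.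
   Lifting the resulting idempotent of A / (I_u I_(1-u)) gives e with u =
   [eA]. *)

Set Implicit Arguments.
Unset Strict Implicit.
Unset Printing Implicit Defensive.

Import GRing.Theory.
Local Open Scope ring_scope.

(** * Functoriality of the tensor product *)

Section TensorFunctor.
Variable A : comPzRingType.
Implicit Types M N : lmodType A.

Definition tensor_hom M N M' N' (f : {linear M -> M'}) (g : {linear N -> N'}) :
  {linear tensor M N -> tensor M' N'} := tensor_bilift (tensor_map2_bilinear f g).

Lemma tensor_homE M N M' N' (f : {linear M -> M'}) (g : {linear N -> N'}) m n :
  tensor_hom f g (pure m n) = pure (f m) (g n).
Proof. exact: tensor_biliftE. Qed.

Lemma tensor_hom_scalel M N M' N' (f : {linear M -> M'}) (f' : {linear M' -> M})
    (g : {linear N -> N'}) (g' : {linear N' -> N}) s t :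
  (forall m, f' (f m) = s *: m) -> (forall n, g' (g n) = t *: n) ->
  forall x, tensor_hom f' g' (tensor_hom f g x) = (s * t) *: x.
Proof.
move=> ff gg; apply: tensor_ext => [x y|x y|m n].
- by rewrite !linearD.
- by rewrite scalerDr.
- by rewrite !tensor_homE ff gg pureZl pureZr scalerA.
Qed.

(** Maps on different factors commute, which lets the cross terms cancel in a product of
    factorizations. *)
Lemma tensor_homC M N M' N' (f : {linear M -> M'}) (g : {linear N -> N'}) x :
  tensor_hom f idfun (tensor_hom idfun g x) =
  tensor_hom idfun g (tensor_hom f idfun x).
Proof.
move: x; apply: tensor_ext => [x y|x y|m n]; rewrite ?linearD //.
by rewrite !tensor_homE.
Qed.
End TensorFunctor.

(** * Arithmetic of formal differences in K_0 *)

Section K0Diff.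
Variable A : comPzRingType.
Implicit Types M N P : lmodType A.

Lemma K0_diffD M N M' N' (fgM : fgprojective M) (fgN : fgprojective N)
    (fgM' : fgprojective M') (fgN' : fgprojective N') :
  K0_diff fgM fgN + K0_diff fgM' fgN' =
  K0_diff (fgprojectiveD fgM fgM') (fgprojectiveD fgN fgN').
Proof. by rewrite [LHS]groth_diffD !iso_classD. Qed.

Lemma K0_diffN M N (fgM : fgprojective M) (fgN : fgprojective N) :
  - K0_diff fgM fgN = K0_diff fgN fgM.
Proof. exact: groth_diffN. Qed.

Lemma K0_diffM M N M' N' (fgM : fgprojective M) (fgN : fgprojective N)
    (fgM' : fgprojective M') (fgN' : fgprojective N') :
  K0_diff fgM fgN * K0_diff fgM' fgN' =
  K0_diff (fgprojectiveD (fgprojectiveM fgM fgM') (fgprojectiveM fgN fgN'))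
          (fgprojectiveD (fgprojectiveM fgM fgN') (fgprojectiveM fgN fgM')).
Proof. by rewrite [LHS]groth_diffM !iso_classM !iso_classD. Qed.

Lemma K0_diff_iso M N (fgM : fgprojective M) (fgN : fgprojective N) :
  module_iso M N -> K0_diff fgM fgN = 0.
Proof.
move=> isoMN; apply/groth_diffP; exists 0.
by rewrite !addr0 add0r; apply/iso_classP.
Qed.

Lemma K0_diffB M N (fgM : fgprojective M) (fgN : fgprojective N) :
  K0_diff fgM (fgprojective0 A) - K0_diff fgN (fgprojective0 A) = K0_diff fgM fgN.
Proof.
by rewrite K0_diffN K0_diffD /K0_diff -!iso_classD -iso_class0 addr0 add0r.
Qed.
End K0Diff.

(** * Rank comparison for free modules *)

Section FreeModules.
Variable A : comPzRingType.
Implicit Types (P : lmodType A) (s : A).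

Lemma fgprojective_rV n : fgprojective 'rV[A]_n.
Proof.
apply/fgprojectiveP.
have lc i : linear (fun x : 'rV[A]_n => x 0 i : A^o) by move=> a x y; rewrite !mxE.
exists 'I_n, (delta_mx 0), (fun i => mklinear (lc i)) => x.
exact: row_sum_delta.
Qed.

Lemma fgprojective_retract P : fgprojective P ->
  exists n (i : {linear P -> 'rV[A]_n}) (p : {linear 'rV[A]_n -> P}), cancel i p.
Proof.
case=> fgP projP; have [n [p surjp]] := fg_surj fgP.
by have [i iK] := projP _ _ p idfun surjp; exists n, i, p.
Qed.

Lemma rV_prod_iso m n : module_iso ('rV[A]_m * 'rV[A]_n)%type 'rV[A]_(m + n).
Proof.
have lr : linear (fun x : 'rV[A]_m * 'rV[A]_n => row_mx x.1 x.2).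
  by move=> a [x y] [x' y'] /=; rewrite scale_row_mx add_row_mx.
apply: (can_module_iso (f := mklinear lr) (g := fun x => (lsubmx x, rsubmx x))).
  by case=> x y /=; rewrite row_mxKl row_mxKr.
by move=> x /=; rewrite hsubmxK.
Qed.

Lemma rV1_iso : module_iso 'rV[A]_1 A^o.
Proof.
have lc : linear (fun x : 'rV[A]_1 => x 0 0 : A^o) by move=> a x y; rewrite !mxE.
apply: (can_module_iso (f := mklinear lc) (g := fun a => a%:M)) => [x|a] /=.
  by rewrite -mx11_scalar.
by rewrite mxE.
Qed.

Lemma K0_diff_rV n : K0_diff (fgprojective_rV n) (fgprojective0 A) = n%:R.
Proof.
elim: n => [|n IHn]; first by apply: K0_diff_iso; apply: module_iso_refl.
rewrite mulrS -IHn [RHS]groth_diffD; apply/groth_diffP; exists 0.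
rewrite !addr0 iso_class1 iso_classD; apply/iso_classP.
apply: module_iso_trans (prod_iso rV1_iso (module_iso_refl _)).
by apply: module_iso_sym; apply: (rV_prod_iso 1 n).
Qed.

(** Padded with zeros, the matrices of [g] and [h] become square and the first has a zero column, so
    the determinant s^m of their product vanishes. *)
Lemma linear_scale_nilpotent m n s (g : {linear 'rV[A]_m -> 'rV[A]_n})
    (h : {linear 'rV[A]_n -> 'rV[A]_m}) :
  (n < m)%N -> (forall x, h (g x) = s *: x) -> s ^+ m = 0.
Proof.
move=> ltnm hg; have Em := subnKC ltnm; move: (m - n.+1)%N Em => k Em.
rewrite addSnnS in Em; subst m.
have GD : lin1_mx g *m lin1_mx h = s%:M.
  by apply/row_matrixP => i; rewrite row_mul rowE !mul_rV_lin1 hg rowE mul_mx_scalar.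
rewrite -det_scalar -GD.
have -> : lin1_mx g *m lin1_mx h =
    row_mx (lin1_mx g) 0 *m col_mx (lin1_mx h) (0 : 'M_(k.+1, n + k.+1)).
  by rewrite mul_row_col mulmx0 addr0.
rewrite det_mulmx (expand_det_col _ (rshift n ord0)) big1 ?mul0r // => i _.
by rewrite row_mxEr mxE mul0r.
Qed.

(* The complement of Y in a free module is adjoined to both sides, where s
   acts as a quasi-inverse of 1. *)
Lemma retract_scale_nilpotent c (Y : lmodType A) s
    (g : {linear ('rV[A]_c * Y)%type -> Y}) (h : {linear Y -> ('rV[A]_c * Y)%type}) :
  (0 < c)%N -> fgprojective Y -> (forall x, h (g x) = s *: x) ->
  exists k, s ^+ k = 0.
Proof.
move=> c_gt0 /fgprojective_retract [n [i [p ipK]]] hg.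
pose G (w : 'rV[A]_(c + n)) : 'rV[A]_n :=
  i (g (lsubmx w, p (rsubmx w))) + s *: (rsubmx w - i (p (rsubmx w))).
pose H (v : 'rV[A]_n) : 'rV[A]_(c + n) :=
  row_mx (h (p v)).1 (i (h (p v)).2 + (v - i (p v))).
have lG : linear G.
  move=> k x y; rewrite /G.
  have -> : lsubmx (k *: x + y) = k *: lsubmx x + lsubmx y by apply/rowP => j; rewrite !mxE.
  have -> : rsubmx (k *: x + y) = k *: rsubmx x + rsubmx y by apply/rowP => j; rewrite !mxE.
  have gP u v u' v' : g (k *: u + u', k *: v + v') = k *: g (u, v) + g (u', v').
    exact: (linearP g k (u, v) (u', v')).
  rewrite (linearP p) gP !(linearP i).
  by apply/rowP => j; rewrite !mxE; ring.
have lH : linear H.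
  move=> k x y; rewrite /H (linearP p) (linearP h) /= !(linearP i) scale_row_mx add_row_mx.
  by congr row_mx; apply/rowP => j; rewrite !mxE; ring.
exists (c + n)%N; apply: (@linear_scale_nilpotent _ _ _ (mklinear lG) (mklinear lH)).
  by rewrite -[ltnLHS]add0n ltn_add2r.
move=> x; rewrite /= /H.
have -> : p (G x) = g (lsubmx x, p (rsubmx x)).
  by rewrite linearD linearZ_LR linearB /= !ipK subrr scaler0 addr0.
rewrite hg /= -[in RHS](hsubmxK x) scale_row_mx; congr row_mx.
by rewrite linearZ_LR /G /=; apply/rowP => j; rewrite !mxE; ring.
Qed.
End FreeModules.

(** * Matrix factorizations of scalars *)

Section Factorizable.
Variable A : comPzRingType.
Implicit Types (M N P : lmodType A) (s t : A) (u v : K0 A).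

(* The pair (a, b) is a matrix factorization of s; inverting s makes it an
   isomorphism, so that v maps to 0 in K_0 of the localization of A at s. *)
Definition factorizable s v : Prop :=
  exists M N (fgM : fgprojective M) (fgN : fgprojective N)
         (a : {linear M -> N}) (b : {linear N -> M}),
    [/\ v = K0_diff fgM fgN, forall x, b (a x) = s *: x & forall y, a (b y) = s *: y].

Lemma factorizable_zero v : factorizable 0 v.
Proof.
have [M [N [fgM [fgN ->]]]] := K0_diffW v.
exists M, N, fgM, fgN, \0, \0; split=> // x; exact: esym (scale0r x).
Qed.

Lemma factorizable_opp s v : factorizable s v -> factorizable s (- v).
Proof.
case=> M [N [fgM [fgN [a [b [-> ba ab]]]]]].
by exists N, M, fgN, fgM, b, a; rewrite K0_diffN.
Qed.

Lemma factorizable_mull t s v : factorizable s v -> factorizable (t * s) v.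
Proof.
case=> M [N [fgM [fgN [a [b [-> ba ab]]]]]].
exists M, N, fgM, fgN, (t \*: a : {linear M -> N}), b; split=> // x /=.
  by rewrite linearZ_LR ba scalerA.
by rewrite ab scalerA.
Qed.

Lemma factorizableD s u v : factorizable s u -> factorizable s v ->
  factorizable s (u + v).
Proof.
case=> M [N [fgM [fgN [a [b [-> ba ab]]]]]] [M' [N' [fgM' [fgN' [c [d [-> dc cd]]]]]]].
have lac : linear (fun x : M * M' => (a x.1, c x.2)).
  by move=> k [x y] [x' y'] /=; rewrite !linearP.
have lbd : linear (fun x : N * N' => (b x.1, d x.2)).
  by move=> k [x y] [x' y'] /=; rewrite !linearP.
exists (M * M')%type, (N * N')%type, (fgprojectiveD fgM fgM'), (fgprojectiveD fgN fgN').
exists (mklinear lac), (mklinear lbd); rewrite K0_diffD.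
by split=> // -[x y] /=; rewrite ?ba ?dc ?ab ?cd.
Qed.

(* The sign makes the two odd endomorphisms anticommute, so that the square of
   their sum is the sum of their squares. *)
Lemma factorizableM s t u v : factorizable s u -> factorizable t v ->
  factorizable (s + t) (u * v).
Proof.
case=> M [N [fgM [fgN [a [b [-> ba ab]]]]]] [M' [N' [fgM' [fgN' [c [d [-> dc cd]]]]]]].
rewrite K0_diffM; set fgE := fgprojectiveD _ _; set fgO := fgprojectiveD _ _.
pose D (x : tensor M M' * tensor N N') : tensor M N' * tensor N M' :=
  (tensor_hom idfun c x.1 + tensor_hom b idfun x.2,
   tensor_hom a idfun x.1 - tensor_hom idfun d x.2).
pose E (x : tensor M N' * tensor N M') : tensor M M' * tensor N N' :=
  (tensor_hom idfun d x.1 + tensor_hom b idfun x.2,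
   tensor_hom a idfun x.1 - tensor_hom idfun c x.2).
have lD : linear D.
  by move=> k [x y] [x' y']; congr (_, _); rewrite /= !linearP ?scalerDr ?scalerN
    ?opprD addrACA.
have lE : linear E.
  by move=> k [x y] [x' y']; congr (_, _); rewrite /= !linearP ?scalerDr ?scalerN
    ?opprD addrACA.
exists _, _, fgE, fgO, (mklinear lD), (mklinear lE).
have idK P (x : P) : idfun (idfun x) = 1 *: x by rewrite scale1r.
have al M1 N1 P (f : {linear M1 -> N1}) (g : {linear N1 -> M1}) k
    (gf : forall z, g (f z) = k *: z) (x : tensor M1 P) :
  tensor_hom g (@idfun P) (tensor_hom f (@idfun P) x) = k *: x.
  by rewrite (tensor_hom_scalel gf (@idK P)) mulr1.
have ar M1 N1 P (f : {linear M1 -> N1}) (g : {linear N1 -> M1}) k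
    (gf : forall z, g (f z) = k *: z) (x : tensor P M1) :
  tensor_hom (@idfun P) g (tensor_hom (@idfun P) f x) = k *: x.
  by rewrite (tensor_hom_scalel (@idK P) gf) mul1r.
split=> // -[x y]; congr (_, _) => /=; rewrite !(linearB, linearD) /= !tensor_homC.
- by rewrite (ar _ _ M _ _ _ dc) (al _ _ M' _ _ _ ba) addrACA subrr addr0 addrC scalerDl.
- by rewrite (ar _ _ N _ _ _ cd) (al _ _ N' _ _ _ ab) opprK addrC addrACA addNr add0r addrC scalerDl.
- by rewrite (ar _ _ M _ _ _ cd) (al _ _ N' _ _ _ ba) addrACA subrr addr0 addrC scalerDl.
- by rewrite (ar _ _ N _ _ _ dc) (al _ _ M' _ _ _ ab) opprK addrC addrACA addNr add0r addrC scalerDl.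
Qed.

(** Every class is 0-factorizable, and s + 0 = s. *)
Lemma factorizableMr s u v : factorizable s u -> factorizable s (u * v).
Proof. by move=> su; rewrite -[s]addr0; apply: factorizableM (factorizable_zero v). Qed.

Lemma factorizable1 v : factorizable 1 v -> v = 0.
Proof.
case=> M [N [fgM [fgN [a [b [-> ba ab]]]]]]; apply: K0_diff_iso.
by apply: (can_module_iso (f := a) (g := b)) => x; rewrite ?ba ?ab scale1r.
Qed.

(** M is stably A^c + N. Through this isomorphism (a, b), completed by (s, 1) on the auxiliary
    summand X, becomes a pair of maps between A^c + Y and Y, where Y = N + X. *)
Lemma factorizable_nat_nilpotent s c : (0 < c)%N -> factorizable s c%:R ->
  exists k, s ^+ k = 0.
Proof.
move=> c_gt0 [M [N [fgM [fgN [a [b [+ ba ab]]]]]]].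
rewrite -K0_diff_rV => /K0_diffP [X [fgX [t [t' tK t'K]]]]; rewrite /= in t t' tK t'K.
have lt' : linear t' by move=> k x y; apply: (can_inj tK); rewrite linearP !t'K.
pose g (x : 'rV[A]_c * (N * X)) : N * X :=
  let q := t ((x.1, x.2.1), x.2.2) in (a q.1.1, s *: q.2).
pose h (y : N * X) : 'rV[A]_c * (N * X) :=
  let q := t' ((b y.1, 0), y.2) in (q.1.1, (q.1.2, q.2)).
have lg : linear g.
  move=> k x y; rewrite /g /=.
  have -> : ((k *: x.1 + y.1, k *: x.2.1 + y.2.1), k *: x.2.2 + y.2.2) =
    k *: (((x.1, x.2.1), x.2.2) : ('rV[A]_c * N) * X) + ((y.1, y.2.1), y.2.2) by [].
  by rewrite linearP /= linearP; congr (_, _); rewrite /= scalerDr !scalerA mulrC.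
have lh : linear h.
  move=> k x y; rewrite /h /=.
  have -> : ((b (k *: x.1 + y.1), 0), k *: x.2 + y.2) =
    k *: (((b x.1, 0), x.2) : (M * 'rV[A]_0) * X) + ((b y.1, 0), y.2).
    by rewrite linearP; congr (_, _, _); rewrite /= scaler0 addr0.
  by rewrite lt'.
apply: (@retract_scale_nilpotent _ _ _ _ (mklinear lg) (mklinear lh) c_gt0).
  exact: fgprojectiveD.
move=> x; rewrite /= /h /g /= ba.
set q := t _; have -> : ((s *: q.1.1, 0), s *: q.2) = s *: q.
  by rewrite /q; case: (t _) => [[q1 q2] q3]; congr (_, _, _) => /=; apply/rowP; case.
have -> : t' (s *: q) = s *: t' q by exact: (linearZ_LR (mklinear lt')).
by rewrite /q tK /=; case: x {q} => [x1 [x2 x3]].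
Qed.
End Factorizable.

(** * Ideals, radicals and determinants *)

Section Ideals.
Variable A : comPzRingType.
Implicit Types (K : A -> Prop) (x y s t : A).

Definition is_ideal K : Prop :=
  [/\ K 0, forall x y, K x -> K y -> K (x + y) & forall a x, K x -> K (a * x)].

Definition radical K x : Prop := exists n, K (x ^+ n).

Lemma exprD_comb x y m n :
  exists a b, (x + y) ^+ (m + n) = a * x ^+ m + b * y ^+ n.
Proof.
elim: m n => [|m IHm] n; first by exists ((x + y) ^+ n), 0; rewrite expr0; ring.
elim: n => [|n [a [b IHn]]]; first by exists 0, ((x + y) ^+ (m.+1 + 0)); rewrite expr0; ring.
have [c [d IHm1]] := IHm n.+1.
exists (c + a * y), (d * x + b); rewrite -addSnnS in IHm1.
(* [IHm1] and [IHn] expand the same power; in the extra factor x + y, x multiplies the first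
   expansion and y the second. *)
by rewrite addnS exprS mulrDl {1}IHm1 IHn !exprS; ring.
Qed.

Lemma radical_ideal K : is_ideal K -> is_ideal (radical K).
Proof.
case=> K0 KD KM; split=> [|x y [m Km] [n Kn]|a x [n Kn]].
- by exists 1%N; rewrite expr1.
- have [a [b e]] := exprD_comb x y m n; exists (m + n)%N; rewrite e.
  by apply: KD; apply: KM.
- by exists n; rewrite exprMn; apply: KM.
Qed.

Lemma radical_exp K x n : radical K (x ^+ n) -> radical K x.
Proof. by case=> m; rewrite -exprM => Km; exists (n * m)%N. Qed.

Lemma colon_ideal K s : is_ideal K -> is_ideal (fun t => K (s * t)).
Proof.
case=> K0 KD KM; split=> [|x y Kx Ky|a x Kx]; first by rewrite mulr0.
  by rewrite mulrDr; apply: KD.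
by rewrite mulrCA; apply: KM.
Qed.

(** Leibniz formula; in each product the factors are exchanged one at a time. *)
Lemma det_congr K n (X Y : 'M[A]_n) : is_ideal K ->
  (forall i j, K (X i j - Y i j)) -> K (\det X - \det Y).
Proof.
case=> K0 KD KM KXY; rewrite -sumrB; elim/big_ind: _ => // sg _.
rewrite -mulrBr; apply: (KM); elim/big_rec2: _ => [|i x y _ Kxy]; first by rewrite subrr.
have -> : X i (sg i) * y - Y i (sg i) * x =
  X i (sg i) * (y - x) + x * (X i (sg i) - Y i (sg i)) by ring.
by apply: KD; apply: KM.
Qed.
End Ideals.

(** * Local freeness of projective modules *)

Section Rank.
Variables (A : comPzRingType) (P : lmodType A) (fgP : fgprojective P).
Variable (K : A -> Prop).
Hypotheses (idK : is_ideal K)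
  (rankK : forall r s, factorizable s (K0_diff fgP (fgprojective0 A) - r%:R) ->
     radical K s).

(* Writing p' = s - b a, one has p' p' = s p', a p' = 0 and p' b = 0. An entry
   t of p' extends (a, b) to P -> A^(r+1) -> P with scalar s t, which gives s
   t in the radical; modulo these entries, s - p' = b a has determinant s^n,
   and up to that determinant b is inverse to a. *)
Lemma rank_radical r s (a : {linear P -> 'rV[A]_r}) (b : {linear 'rV[A]_r -> P}) :
  (forall x, a (b x) = s *: x) -> radical K s.
Proof.
have [n [i [p ipK]]] := fgprojective_retract fgP.
have idR := radical_ideal idK.
(* Induction on k with n < r + k. Each step raises r by one; at k = 0, s on A^r factors through the
   smaller A^n and is nilpotent. *)
have: (n < r + n.+1)%N by rewrite addnS ltnS leq_addl.
elim: {2}n.+1 r s a b => [|k IHk] r s a b lt_n ab.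
  rewrite addn0 in lt_n; exists r.
  have -> : s ^+ r = 0; last by case: idK.
  by apply: (linear_scale_nilpotent (g := i \o b) (h := a \o p)) => // x /=; rewrite ipK.
have [q qE] : exists q : {linear P -> P}, forall x, q x = s *: x - b (a x).
  by exists ((s \*: idfun) \- (b \o a)).
have qb x : q (b x) = 0 by rewrite qE ab linearZ_LR subrr.
have aq x : a (q x) = 0 by rewrite qE linearB linearZ_LR /= ab subrr.
have qq x : q (q x) = s *: q x by rewrite {1}qE aq linear0 subr0.
have [X XE] : exists X, X = lin1_mx (i \o q \o p) by eexists.
have radX j l : radical K (s * X j l).
  set t := X j l.
  have [w wE] : exists w, w = q (p (delta_mx 0 j)) by eexists.
  have tE : i (q w) 0 l = s * t by rewrite wE qq linearZ_LR mxE /t XE mxE.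
  (* The new coordinate of [w] is s t because q q = s q; the old ones are scaled by [t] so that they
     too yield s t. *)
  pose a' (x : P) : 'rV[A]_(r + 1) := row_mx (t *: a x) (i (q x) 0 l)%:M.
  pose b' (x : 'rV[A]_(r + 1)) : P := b (lsubmx x) + x 0 (rshift r 0) *: w.
  have la' : linear a'.
    move=> c x y; rewrite /a' (linearP a) (linearP q) (linearP i) scale_row_mx add_row_mx.
    congr row_mx; first by rewrite scalerDr !scalerA mulrC.
    by apply/rowP => m; rewrite !mxE (ord1 m).
  have lb' : linear b'.
    move=> c x y; rewrite /b' !mxE.
    have -> : lsubmx (c *: x + y) = c *: lsubmx x + lsubmx y by apply/rowP => m; rewrite !mxE.
    by rewrite (linearP b) scalerDr scalerDl scalerA addrACA.
  apply: (IHk (r + 1)%N (s * t) (mklinear la') (mklinear lb')).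
    by rewrite -addnA add1n.
  have aw : a w = 0 by rewrite wE aq.
  move=> x /=; rewrite /a' /b' (linearD a) (linearZ_LR a) aw ab scaler0 addr0.
  rewrite (linearD q) qb add0r (linearZ_LR q) (linearZ_LR i).
  rewrite -[in RHS](hsubmxK x) scale_row_mx scalerA [s * t]mulrC; congr row_mx.
  by apply/rowP => m; rewrite !mxE (ord1 m) eqxx mulr1n tE; ring.
pose G := s%:M - X; have [s2 s2E] : exists s2, s2 = \det G by eexists.
(* As b a p = p G, inserting the adjugate of [G] gives b c = det G. *)
pose c : {linear P -> 'rV[A]_r} := a \o p \o mulmxr (\adj G) \o i.
have bc z : b (c z) = s2 *: z.
  have ba y : b (a (p y)) = p (y *m G).
    have -> : b (a (p y)) = s *: p y - q (p y) by rewrite qE subKr.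
    rewrite mulmxBr mul_mx_scalar XE mul_rV_lin1 (linearB p) (linearZ_LR p) /=.
    by rewrite ipK.
  by rewrite [c z]/= ba -mulmxA mul_adj_mx mul_mx_scalar -s2E (linearZ_LR p) ipK.
(* The factor s = a b reduces the composite on A^r to the known identity b c = [s2]. *)
have radss2 : radical K (s * s2).
  apply: (rankK (r := r)); rewrite -K0_diff_rV K0_diffB.
  exists P, 'rV[A]_r, fgP, (fgprojective_rV A r), (s \*: c : {linear P -> 'rV_r}), b.
  split=> // z.
    by rewrite [_ z]/= (linearZ_LR b) bc scalerA.
  by rewrite [LHS]/= -ab bc (linearZ_LR a) ab scalerA mulrC.
apply: (@radical_exp _ K s n.+1).
have -> : s ^+ n.+1 = s * s2 + (-1) * (s * (s2 - s ^+ n)) by rewrite exprS; ring.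
have [_ RD RM] := idR; apply: RD => //; apply: (RM); rewrite s2E -(det_scalar n).
apply: (det_congr (colon_ideal s idR)) => j l; rewrite /G !mxE.
have -> : s * (s *+ (j == l) - X j l - s *+ (j == l)) = (-1) * (s * X j l) by ring.
exact: RM.
Qed.

(** [rank_radical] applies with r = 0 and s = 1, since zero maps compose to the identity of A^0.
    This is local freeness of P without localizations. *)
Lemma rank_ideal : K 1.
Proof.
have [n] : radical K 1; last by rewrite expr1n.
apply: (@rank_radical 0 1 \0 \0) => x.
by apply/rowP; case.
Qed.
End Rank.

(** * The module eA of an idempotent e *)

Section IdempotentModule.
Variables (A : comPzRingType) (e : A).

(** For idempotent e this is eA, cut out by an equation to get a boolean predicate. *)
Definition fixed_by : {pred A^o} := fun x => e * (x : A) == x.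

Lemma fixed_by_submod : submod_closed fixed_by.
Proof.
split=> [|a x y /eqP ex /eqP ey]; rewrite /in_mem /=; apply/eqP; first exact: mulr0.
by rewrite mulrDr ey; congr (_ + _); rewrite [e * _]mulrCA ex.
Qed.

HB.instance Definition _ := GRing.isSubmodClosed.Build A A^o fixed_by fixed_by_submod.

Record fixed_mod : Type := FixedMod {fixed_val : A^o; _ : fixed_val \in fixed_by}.
HB.instance Definition _ := [isSub for fixed_val].
HB.instance Definition _ := [Choice of fixed_mod by <:].
HB.instance Definition _ := [SubChoice_isSubLmodule of fixed_mod by <:].

Lemma fixed_val_linear : linear fixed_val.
Proof. by []. Qed.

Lemma fixed_valP (x : fixed_mod) : e * (fixed_val x : A) = fixed_val x.
Proof. by apply/eqP; case: x. Qed.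

Hypothesis eK : e * e = e.

Lemma fixed_mul_subproof (x : A) : (e * x : A^o) \in fixed_by.
Proof. by apply/eqP; rewrite mulrA eK. Qed.

Definition fixed_mul (x : A^o) : fixed_mod := FixedMod (fixed_mul_subproof x).

Lemma fixed_mul_linear : linear fixed_mul.
Proof. by move=> a x y; apply/val_inj; rewrite /= mulrDr; congr (_ + _); apply: mulrCA. Qed.

Lemma fixed_mod_fgprojective : fgprojective fixed_mod.
Proof.
apply/fgprojectiveP; exists unit, (fun _ => fixed_mul 1), (fun _ => mklinear fixed_val_linear).
move=> x; rewrite (big_pred1 tt) => [|[]//]; apply/val_inj; rewrite /= mulr1.
by rewrite -[LHS]fixed_valP; apply: mulrC.
Qed.

(** 1 - e kills eA, so it factors through 0; multiplication by e from A to eA and the inclusion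
    compose to e both ways. *)
Lemma idempotent_class :
  exists v : K0 A, factorizable (1 - e) v /\ factorizable e (1 - v).
Proof.
exists (K0_diff fixed_mod_fgprojective (fgprojective0 A)); split.
  exists _, _, fixed_mod_fgprojective, (fgprojective0 A), \0, \0.
  split=> // x /=; last by apply/rowP; case.
  by apply/val_inj; rewrite /= [RHS]mulrBl mul1r fixed_valP subrr.
exists _, _, (fgprojective1 A), fixed_mod_fgprojective.
exists (mklinear fixed_mul_linear), (mklinear fixed_val_linear); split=> //.
  rewrite K0_diffN [LHS]groth_diffD; congr groth_diff; last exact: add0r.
  exact: addr0.
by move=> y; apply/val_inj.
Qed.
End IdempotentModule.

(** * Base change of factorizations *)

Section BaseChange.
Variables (A B : comPzRingType) (f : {rmorphism A -> B}).
Implicit Types (M N : lmodType A) (s : A).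

Lemma extend_hom_exists M N (g : {linear M -> N}) :
  exists h : {linear extend f M -> extend f N},
    forall m, h (epure f m 1) = epure f (g m) 1.
Proof.
have gD : {morph (fun m => epure f (g m) 1) : x y / x + y}.
  by move=> x y; rewrite linearD epureDl.
have gZ a x : epure f (g (a *: x)) 1 = f a *: epure f (g x) 1.
  by rewrite linearZ_LR epureZl epureZ.
by exists (extend_lift gD gZ) => m; rewrite extend_liftE scale1r.
Qed.

Lemma extend_scale_ext M s (h : {linear extend f M -> extend f M}) :
  (forall m, h (epure f m 1) = epure f (s *: m) 1) -> forall x, h x = f s *: x.
Proof.
move=> hE; apply: extend_ext => [||m]; first exact: linearP.
  by move=> b x y; rewrite scalerDr !scalerA mulrC.
by rewrite hE epureZl epureZ.
Qed.

Lemma K0_map_factorizable s v : factorizable s v -> factorizable (f s) (K0_map f v).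
Proof.
case=> M [N [fgM [fgN [a [b [-> ba ab]]]]]]; rewrite K0_mapE.
have [a' a'E] := extend_hom_exists a; have [b' b'E] := extend_hom_exists b.
exists _, _, (fgprojective_extend f fgM), (fgprojective_extend f fgN), a', b'.
split=> //; [apply: (@extend_scale_ext _ _ (b' \o a'))|apply: (@extend_scale_ext _ _ (a' \o b'))].
  by move=> m /=; rewrite a'E b'E ba.
by move=> m /=; rewrite b'E a'E ab.
Qed.
End BaseChange.

(** * Idempotents of A and of K_0(A) *)

Section Idempotents.
Variable A : comPzRingType.
Implicit Types (e s t : A) (u v w : K0 A).

(** Stands for v = [eA], in a form that base change preserves at once. *)
Definition represents e v := factorizable (1 - e) v /\ factorizable e (1 - v).

(** v (1 - w) is factorizable for (1 - e) + e = 1, hence zero. *)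
Lemma represents_mul e v w : represents e v -> represents e w -> v * w = v.
Proof.
case=> ev _ [_ ew]; apply/esym/eqP; rewrite -subr_eq0 -[X in X - _]mulr1 -mulrBr.
by apply/eqP/factorizable1; have := factorizableM ev ew; rewrite subrK.
Qed.

Lemma represents_unique e v w : represents e v -> represents e w -> v = w.
Proof.
move=> ev ew; rewrite -(represents_mul ev ew) mulrC.
exact: (represents_mul ew ev).
Qed.

Lemma nilpotent_idempotent e n : e * e = e -> e ^+ n = 0 -> e = 0.
Proof.
move=> eK e0; have eX k : e ^+ k.+1 = e.
  by elim: k => [|k IHk]; rewrite ?expr1 // exprS IHk.
by rewrite -(eX n) exprS e0 mulr0.
Qed.

(** Both v and 1 - v are s t-factorizable, hence so is their sum 1. *)
Lemma factorizable_split s t v : factorizable s v -> factorizable t (1 - v) ->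
  exists k, (s * t) ^+ k = 0.
Proof.
move=> sv tv; apply: (@factorizable_nat_nilpotent _ _ 1) => //.
rewrite -[1%:R](subrK v) addrC; apply: factorizableD; last exact: factorizable_mull.
by rewrite mulrC; apply: factorizable_mull.
Qed.

(** (1 - e) e' is idempotent, and nilpotent by [factorizable_split]. *)
Lemma represents_le e e' v : e * e = e -> e' * e' = e' ->
  represents e v -> represents e' v -> e' = e * e'.
Proof.
move=> eK e'K [ev _] [_ e'v]; have [k /nilpotent_idempotent e0] := factorizable_split ev e'v.
apply/eqP; rewrite -subr_eq0 -[X in X - _]mul1r -mulrBl e0 //.
by rewrite mulrACA e'K; congr (_ * _); rewrite mulrBl mul1r mulrBr mulr1 eK; ring.
Qed.

Lemma represents_inj e e' v : e * e = e -> e' * e' = e' ->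
  represents e v -> represents e' v -> e = e'.
Proof.
move=> eK e'K ev e'v; rewrite (represents_le eK e'K ev e'v) mulrC.
exact: (represents_le e'K eK e'v ev).
Qed.

(** Expanding a power of s + t = 1 gives 1 = a s^n + b t^n with orthogonal summands once (s t)^n =
    0. *)
Lemma lift_comaximal_idempotent s t k : s + t = 1 -> (s * t) ^+ k = 0 ->
  exists e a b, [/\ e * e = e, e = a * t & 1 - e = b * s].
Proof.
(* Exponent 0 forces A = 0; a positive one leaves a factor t in e and s in 1 - e. *)
move=> st1 st0; case: k st0 => [|k] st0.
  have z x : x = 0 :> A by rewrite -[x]mulr1 -(expr0 (s * t)) st0 mulr0.
  by exists 0, 0, 0; rewrite [1 - 0]z !mul0r.
have [a [b]] := exprD_comb s t k.+1 k.+1; rewrite st1 expr1n => ab1.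
have ab0 : (a * s ^+ k.+1) * (b * t ^+ k.+1) = 0 by rewrite mulrACA -exprMn st0 mulr0.
exists (b * t ^+ k.+1), (b * t ^+ k), (a * s ^+ k).
split; last 2 first.
- by rewrite exprSr mulrA.
- by rewrite ab1 addrK exprSr mulrA.
by rewrite -[RHS]mul1r ab1 mulrDl ab0 add0r.
Qed.

Lemma represents_exists u : u * u = u -> exists2 e, e * e = e & represents e u.
Proof.
move=> uK; have u'K : (1 - u) * (1 - u) = 1 - u.
  by rewrite mulrBl mul1r mulrBr mulr1 uK; ring.
(* Idempotency of v turns the product rule into additivity in the scalar. *)
have FD v s t : v * v = v -> factorizable s v -> factorizable t v -> factorizable (s + t) v.
  by move=> vK sv tv; rewrite -vK; apply: factorizableM.
pose K x := exists s t, [/\ x = s + t, factorizable s u & factorizable t (1 - u)].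
have idK : is_ideal K.
  split=> [|_ _ [s [t [-> su tu]]] [s' [t' [-> su' tu']]]|a _ [s [t [-> su tu]]]].
  - by exists 0, 0; rewrite addr0; split=> //; apply: factorizable_zero.
  - by exists (s + s'), (t + t'); rewrite addrACA; split=> //; apply: FD.
  - by exists (a * s), (a * t); rewrite mulrDr; split=> //; apply: factorizable_mull.
suff [s [t [st1 su tu]]] : K 1.
  have [k st0] := factorizable_split su tu.
  have [e [a [b [eK ea eb]]]] := lift_comaximal_idempotent (esym st1) st0.
  exists e => //; split; first by rewrite eb; apply: factorizable_mull.
  by rewrite ea; apply: factorizable_mull.
have FB s j : factorizable s (u - j) -> factorizable s (j * j - j).
  move=> /(factorizableMr (1 - u - j)).
  have -> // : (u - j) * (1 - u - j) = j * j - j.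
  have -> : (u - j) * (1 - u - j) = u - u * u + (j * j - j) by ring.
  by rewrite uK subrr add0r.
have rad0 s n : (0 < n)%N -> factorizable s (n%:R : K0 A) -> radical K s.
  move=> n_gt0 /(factorizable_nat_nilpotent n_gt0) [k sk0]; exists k.
  by rewrite sk0; case: idK.
(* Let j = r - r'. If j = 0, u is s-factorizable; if j = 1, 1 - u is; otherwise j^2 - j is a
   positive integer. *)
have radK s r r' : factorizable s (u - (r%:R - r'%:R)) -> radical K s.
  case: (leqP r' r) => [/subnKC|/subnKC] <-; move: (_ - _)%N => d.
    have -> : (r' + d)%:R - r'%:R = d%:R :> K0 A by rewrite natrD addrC addKr.
    case: d => [|[|d]] su.
    - exists 1%N, s, 0; rewrite expr1 addr0; split=> //; last exact: factorizable_zero.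
      by rewrite subr0 in su.
    - exists 1%N, 0, s; rewrite expr1 add0r; split=> //; first exact: factorizable_zero.
      by rewrite -opprB; apply: factorizable_opp.
    apply: (rad0 s (d.+2 * d.+1)%N) => //.
    have -> : (d.+2 * d.+1)%:R = d.+2%:R * d.+2%:R - d.+2%:R :> K0 A by ring.
    exact: FB.
  have -> : r%:R - (r.+1 + d)%:R = - d.+1%:R :> K0 A by ring.
  move=> /FB su; apply: (rad0 s (d.+1 * d.+2)%N) => //.
  have -> // : (d.+1 * d.+2)%:R = - d.+1%:R * - d.+1%:R - - d.+1%:R :> K0 A by ring.
have [M [N [fgM [fgN uE]]]] := K0_diffW u.
(* Local freeness is used for M with [K], then, for each s, for N with the ideal of those t such
   that s t is in the radical of [K]; s t serves both ranks. *)
apply: (rank_ideal (fgP := fgM)) => // r s Ms.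
have [n] : radical K (s * 1); last by rewrite mulr1; exists n.
apply: (rank_ideal (fgP := fgN) (K := fun t => radical K (s * t))) => [|r' t Nt].
  exact/colon_ideal/radical_ideal.
exists 1%N; rewrite expr1; apply: (@radK _ r r').
have -> : u - (r%:R - r'%:R) = (K0_diff fgM (fgprojective0 A) - r%:R) -
    (K0_diff fgN (fgprojective0 A) - r'%:R).
  by rewrite uE -K0_diffB; ring.
apply: factorizableD; first by rewrite mulrC; apply: factorizable_mull.
by apply: factorizable_opp; apply: factorizable_mull.
Qed.
End Idempotents.

(** * Lifting along a ring morphism *)

Theorem corollary4p11 (A B : comPzRingType) (f : {rmorphism A -> B}) :
  lifts_idempotents f <-> lifts_idempotents (K0_map f).
Proof.
have f_represents e v : represents e v -> represents (f e) (K0_map f v).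
  case=> /(K0_map_factorizable f) + /(K0_map_factorizable f).
  by rewrite !rmorphB !rmorph1.
split=> lift_f.
  move=> u /represents_exists [e' e'K e'u].
  have [e [eK fe]] := lift_f _ e'K.
  have [v ev] := idempotent_class eK; exists v; split; first exact: (represents_mul ev ev).
  (* Both classes belong to e' = f e. *)
  by apply: (represents_unique _ e'u); rewrite -fe; apply: f_represents.
move=> e' e'K; have [u e'u] := idempotent_class e'K.
have [v [vK fv]] := lift_f u (represents_mul e'u e'u).
have [e eK ev] := represents_exists vK; exists e; split=> //.
(* Both idempotents f e and e' have class u. *)
apply: (represents_inj (v := u)) => //; first by rewrite -rmorphM eK.
by rewrite -fv; apply: f_represents.
Qed.
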